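(* Let $k\le n$ and $s$ be positive integers and let $\lambda$ be a partition of $k$ with at most $s$ parts. Then $$\mathrm{Hilb}_q(R_{n,\lambda,s})=\sum_{\varphi\in\mathrm{SECI}_{n,\lambda,s}}q^{\mathrm{inv}(\varphi)}=\sum_{\varphi\in\mathrm{SECI}_{n,\lambda,s}}q^{\mathrm{dinv}(\varphi)}.$$
   Context: A partition $\lambda=(\lambda_1\ge\dots\ge\lambda_{\ell(\lambda)}>0)$ has length $\ell(\lambda)$; set $\lambda_i=0$ for $i>\ell(\lambda)$, and let $\lambda'_j=\#\{i:\lambda_i\ge j\}$ be the parts of the conjugate partition (with $\lambda'_j=0$ for large $j$). Let $\mathbf{x}_n=\{x_1,\dots,x_n\}$. For $S\subseteq\mathbf{x}_n$ and $d\ge1$, $e_d(S)$ is the sum of all squarefree monomials of degree $d$ in the variables in $S$ (so $e_d(S)=0$ if $d>|S|$). For $0\le m\le n$ let $p^n_m(\lambda)=\lambda'_n+\lambda'_{n-1}+\dots+\lambda'_{n-m+1}$. Define $$I_{n,\lambda,s}=\langle x_i^s : 1\le i\le n\rangle+\langle e_d(S): S\subseteq\mathbf{x}_n,\ d>|S|-p^n_{|S|}(\lambda)\rangle,\qquad R_{n,\lambda,s}=\mathbb{Q}[\mathbf{x}_n]/I_{n,\lambda,s},$$ graded by polynomial degree. For graded $V=\bigoplus_iV_i$, $\mathrm{Hilb}_q(V)=\sum_i\dim_{\mathbb{Q}}(V_i)q^i$. Extended column-increasing fillings. Cells are pairs $(i,j)$ with $i$ the column (numbered from the left) and $j$ the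 row (numbered upward). Let $\mathrm{dg}'(\lambda)=\{(i,j):1\le i\le s,\ 1\le j\le\lambda_i\}$. An element $\varphi\in\mathrm{SECI}_{n,\lambda,s}$ consists of a set of basement cells $B(\varphi)=\{(i,j):1\le i\le s,\ -b_i<j\le0\}$ for some nonnegative integers $b_1,\dots,b_s$, such that $D(\varphi)=\mathrm{dg}'(\lambda)\cup B(\varphi)$ has exactly $n$ cells, together with a labeling $(i,j)\mapsto\varphi_{i,j}$ of $D(\varphi)$ by $1,\dots,n$, each used exactly once, that increases down each column ($\varphi_{i,j}<\varphi_{i,j'}$ if $j>j'$). $\mathrm{inv}(\varphi)$ is the total number of the following: (I1) pairs $((i,j),(i',j'))$ of cells of $\mathrm{dg}'(\lambda)$ with $\varphi_{i,j}>\varphi_{i',j'}$ and either $j=j'$, $i<i'$, or $j=j'+1$, $i>i'$; (I2) pairs $((i,1),(i',j'))$ with $(i,1)\in\mathrm{dg}'(\lambda)$, $(i',j')\in B(\varphi)$, $i>i'$ and $\varphi_{i,1}>\varphi_{i',j'}$; (I3) pairs $(i,(i',j'))$ with $(i',j')\in B(\varphi)$ and $i$ an integer with $1\le i<i'$. A $\lambda$-attacking pair is a pair of coordinates $((i,j),(i',j'))$ with $1\le i,i'\le s$, $j\le\lambda_i$, $j'\le\lambda_{i'}$ ($j,j'$ any integers) such that either $j=j'$ and $i<i'$, or $j=j'+1$ and $i>i'$. $\mathrm{dinv}(\varphi)$ is the number of $\lambda$-attacking pairs $((i,j),(i',j'))$ such that either (D1) both $(i,j),(i',j')\in D(\varphi)$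 and $\varphi_{i,j}>\varphi_{i',j'}$, or (D2) $j,j'\le0$, $(i,j)\notin D(\varphi)$ and $(i',j')\in D(\varphi)$. *)

(* Defs.v *)
From HB Require Import structures.
From mathcomp Require Import all_boot all_order all_algebra finmap mpoly.
From mathcomp Require Import boolp classical_sets functions cardinality fsbigop.

Set Implicit Arguments.
Unset Strict Implicit.
Unset Printing Implicit Defensive.

Import Order.TTheory GRing.Theory Num.Theory.

Local Open Scope classical_set_scope.
Local Open Scope ring_scope.

Definition is_partition_of (k : nat) (la : seq nat) : bool :=
  [&& sorted geq la, 0%N \notin la & sumn la == k].

(* The length of a partition is [size la]; its parts are indexed from 0 here,
   so that [part la i] is the (i+1)-st part, and 0 past the end. *)
Definition part (la : seq nat) (i : nat) : nat := nth 0%N la i.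

Definition conj_part (la : seq nat) (j : nat) : nat :=
  count (fun p => (j <= p)%N) la.

(* la'_n + la'_(n-1) + ... + la'_(n-m+1), for m <= n *)
Definition pnm (n m : nat) (la : seq nat) : nat :=
  (\sum_((n - m).+1 <= j < n.+1) conj_part la j)%N.

Section GeneratedIdeal.
Variables (n : nat) (G : set {mpoly rat[n]}).

Definition ideal_gen : {pred {mpoly rat[n]}} := fun f =>
  `[< exists t : seq ({mpoly rat[n]} * {mpoly rat[n]}),
        (forall u, u \in t -> G u.2) /\ f = \sum_(u <- t) u.1 * u.2 >].

Lemma ideal_genMr f g : g \in ideal_gen -> f * g \in ideal_gen.
Proof.
case/asboolP=> t [Gt ->]; apply/asboolP.
exists [seq (f * u.1, u.2) | u <- t]; split.
  by move=> u /mapP[v vt ->] /=; exact: Gt vt.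
by rewrite big_map mulr_sumr; apply: eq_bigr => u _; rewrite mulrA.
Qed.

Lemma ideal_gen_zmod_closed : zmod_closed ideal_gen.
Proof.
split; first by apply/asboolP; exists [::]; split=> //; rewrite big_nil.
move=> f g If Ig; have := ideal_genMr (-1) Ig; rewrite mulN1r.
case/asboolP=> t [Gt ->]; case/asboolP: If => r [Gr ->].
apply/asboolP; exists (r ++ t); split; last by rewrite big_cat.
by move=> u; rewrite mem_cat => /orP[/Gr|/Gt].
Qed.

HB.instance Definition _ :=
  GRing.isZmodClosed.Build {mpoly rat[n]} ideal_gen ideal_gen_zmod_closed.

End GeneratedIdeal.

(* The library's quotient by an ideal is an additive group (and a ring when
   the ideal is proper); we add the scalar action of the rationals. *)
Definition mpoly_quot (n : nat) (G : set {mpoly rat[n]}) :=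
  {ideal_quot (ideal_gen G)}.

HB.instance Definition _ (n : nat) (G : set {mpoly rat[n]}) :=
  GRing.Zmodule.on (mpoly_quot G).

Section QuotientModule.
Variables (n : nat) (G : set {mpoly rat[n]}).
Local Notation Q := (mpoly_quot G).

Definition to_quot (f : {mpoly rat[n]}) : Q := (\pi_{ideal_quot (ideal_gen G)} f)%qT.
Definition of_quot (x : Q) : {mpoly rat[n]} := repr x.

Lemma of_quotK : cancel of_quot to_quot.
Proof. exact: reprK. Qed.

Lemma to_quotP f g : to_quot f = to_quot g <-> f - g \in ideal_gen G.
Proof.
rewrite Quotient.idealrBE; split=> [e|/eqP //]; exact/eqP.
Qed.

Lemma to_quotD f g : to_quot (f + g) = to_quot f + to_quot g.
Proof. exact: raddfD. Qed.

Definition scale_quot (c : rat) (x : Q) : Q := to_quot (c *: of_quot x).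

Lemma scale_quotE c f : scale_quot c (to_quot f) = to_quot (c *: f).
Proof.
apply/to_quotP; rewrite -scalerBr -mul_mpolyC; apply: ideal_genMr.
by apply/to_quotP; rewrite of_quotK.
Qed.

Lemma scale_quotA a b x : scale_quot a (scale_quot b x) = scale_quot (a * b) x.
Proof. by rewrite -[x]of_quotK !scale_quotE scalerA. Qed.

Lemma scale_quot1 : left_id 1 scale_quot.
Proof. by move=> x; rewrite -[x]of_quotK scale_quotE scale1r. Qed.

Lemma scale_quotDr : right_distributive scale_quot +%R.
Proof.
move=> c x y; rewrite -[x]of_quotK -[y]of_quotK.
by rewrite -to_quotD !scale_quotE scalerDr to_quotD.
Qed.

Lemma scale_quotDl x : {morph scale_quot^~ x : a b / a + b}.
Proof.
by move=> a b; rewrite -[x]of_quotK !scale_quotE scalerDl to_quotD.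
Qed.

HB.instance Definition _ := GRing.Zmodule_isLmodule.Build rat (mpoly_quot G)
  scale_quotA scale_quot1 scale_quotDr scale_quotDl.

Definition quot_degree (d : nat) : set (mpoly_quot G) :=
  [set to_quot f | f in [set f : {mpoly rat[n]} | f \is d.-homog]].

End QuotientModule.

Definition has_dim (F : fieldType) (V : lmodType F) (W : set V) (d : nat) :=
  exists b : 'I_d -> V,
    [/\ forall i, W (b i),
        forall c : 'I_d -> F, \sum_i c i *: b i = 0 -> forall i, c i = 0
      & forall v, W v -> exists c : 'I_d -> F, v = \sum_i c i *: b i].

(* [P] is the Hilbert series of the graded space with pieces [V_ d]: each piece
   is finite-dimensional, with dimension the corresponding coefficient of [P] *)
Definition is_Hilbert_series (F : fieldType) (V : lmodType F)
    (V_ : nat -> set V) (P : {poly nat}) :=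
  forall d : nat, has_dim (V_ d) (P`_d)%R.

Definition e_poly (n : nat) (S : {set 'I_n}) (d : nat) : {mpoly rat[n]} :=
  \sum_(T : {set 'I_n} | (T \subset S) && (#|T| == d)) \prod_(i in T) 'X_i.

(* The inequality d > |S| - p is written without truncated subtraction.  The
   ideal generated by a union of sets is the sum of the ideals they generate. *)
Definition I_gens (n : nat) (la : seq nat) (s : nat) : set {mpoly rat[n]} :=
  [set 'X_i ^+ s | i in [set: 'I_n]] `|`
  [set f | exists (S : {set 'I_n}) (d : nat),
     [/\ (0 < d)%N, (#|S| < d + pnm n #|S| la)%N & f = e_poly S d]].

Arguments I_gens : clear implicits.

Definition R_quot (n : nat) (la : seq nat) (s : nat) : lmodType rat :=
  mpoly_quot (I_gens n la s).

Definition R_degree (n : nat) (la : seq nat) (s : nat) (d : nat) :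
    set (R_quot n la s) :=
  @quot_degree n (I_gens n la s) d.

Arguments R_degree : clear implicits.

(* (column, row), with columns numbered from 0 *)
Definition cell (s : nat) : Type := ('I_s * int)%type.
HB.instance Definition _ (s : nat) := Countable.on (cell s).

(* A labeling of a finite set of cells is a finite map, whose domain is D(phi);
   it determines the basement, which is the part of D(phi) in rows <= 0. *)
Definition filling (s : nat) : Type := {fmap cell s -> nat}.
HB.instance Definition _ (s : nat) := Choice.on (filling s).

Section Fillings.
Variables (n : nat) (la : seq nat) (s : nat).
Implicit Types (c : cell s) (phi : filling s).

Definition dg : set (cell s) := [set c : cell s | 1 <= c.2 <= (part la c.1)%:Z].

Definition basement (b : 'I_s -> nat) : set (cell s) :=
  [set c : cell s | - (b c.1)%:Z < c.2 <= 0].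

Definition cells phi : set (cell s) := [set c : cell s | c \in domf phi].
Definition bcells phi : set (cell s) := [set c : cell s | cells phi c /\ c.2 <= 0].

(* 0 outside of the domain *)
Definition label phi c : nat := odflt 0%N phi.[? c]%fmap.

Definition SECI : set (filling s) :=
  [set phi |
    [/\ exists b : 'I_s -> nat, cells phi = dg `|` basement b,
        #|` domf phi| = n,
        set_bij (cells phi) [set m : nat | (1 <= m <= n)%N] (label phi)
      & forall (i : 'I_s) (j j' : int),
          cells phi (i, j) -> cells phi (i, j') -> j' < j ->
          (label phi (i, j) < label phi (i, j'))%N]].

Definition count_set (T : choiceType) (A : set T) : nat := #|` fset_set A|.

Definition attacks c c' : Prop :=
  (c.2 = c'.2 /\ (c.1 < c'.1)%N) \/ (c.2 = c'.2 + 1 /\ (c'.1 < c.1)%N).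

Definition inv1 phi : set (cell s * cell s) :=
  [set p | [/\ dg p.1, dg p.2, (label phi p.2 < label phi p.1)%N
             & attacks p.1 p.2]].

Definition inv2 phi : set (cell s * cell s) :=
  [set p | [/\ dg p.1 /\ p.1.2 = 1, bcells phi p.2, (p.2.1 < p.1.1)%N
             & (label phi p.2 < label phi p.1)%N]].

Definition inv3 phi : set ('I_s * cell s) :=
  [set p : 'I_s * cell s | bcells phi p.2 /\ (p.1 < p.2.1)%N].

Definition seci_inv phi : nat :=
  (count_set (inv1 phi) + count_set (inv2 phi) + count_set (inv3 phi))%N.

Definition la_attacking c c' : Prop :=
  [/\ c.2 <= (part la c.1)%:Z, c'.2 <= (part la c'.1)%:Z & attacks c c'].

Definition dinv_pairs phi : set (cell s * cell s) :=
  [set p | la_attacking p.1 p.2 /\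
    ([/\ cells phi p.1, cells phi p.2 & (label phi p.2 < label phi p.1)%N] \/
     [/\ p.1.2 <= 0, p.2.2 <= 0, ~ cells phi p.1 & cells phi p.2])].

Definition seci_dinv phi : nat := count_set (dinv_pairs phi).

(* [count_set] and the sums over [SECI] would be junk on infinite sets: *)

Lemma cells_finite phi : finite_set (cells phi).
Proof. exact: finite_fset. Qed.

Lemma bcells_finite phi : finite_set (bcells phi).
Proof. by apply: sub_finite_set (cells_finite phi) => c []. Qed.

Lemma dg_finite : finite_set dg.
Proof.
have fin : finite_set [set (i, Posz m) | i in [set: 'I_s]
                                       & m in `I_(sumn la).+1].
  by apply: finite_image2 => //; exact: finite_II.
apply: sub_finite_set fin => -[i [m|m]] /=; last by rewrite /dg /=.
rewrite /dg /= lez_nat => /andP[_ le_m]; exists i => //; exists m => //=.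
rewrite ltnS; apply: leq_trans le_m _; rewrite /part.
elim: la (nat_of_ord i) => [|x l IHl] [|j] //=; first exact: leq_addr.
exact: leq_trans (IHl j) (leq_addl _ _).
Qed.

Lemma inv1_finite phi : finite_set (inv1 phi).
Proof.
by apply: sub_finite_set (finite_setX dg_finite dg_finite) => p [].
Qed.

Lemma inv2_finite phi : finite_set (inv2 phi).
Proof.
apply: sub_finite_set (finite_setX dg_finite (bcells_finite phi)) => p.
by case=> -[].
Qed.

Lemma inv3_finite phi : finite_set (inv3 phi).
Proof.
apply: (@sub_finite_set _ _ ([set: 'I_s] `*` bcells phi)); first by move=> p [].
by apply: finite_setX (bcells_finite phi).
Qed.

Lemma dinv_pairs_finite phi : finite_set (dinv_pairs phi).
Proof.
pose f (c : cell s) (u : 'I_s * bool) : cell s * cell s :=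
  ((u.1, c.2 + (nat_of_bool u.2)%:Z), c).
have fin : finite_set [set f c u | c in cells phi & u in [set: 'I_s * bool]].
  by apply: finite_image2 => //; exact: cells_finite.
apply: sub_finite_set fin => -[[i j] [i' j']] [[_ _ /= att] D].
have D' : cells phi (i', j') by case: D => -[].
exists (i', j') => //; case: att => /= -[-> _].
  by exists (i, false); rewrite // /f /= addr0.
by exists (i, true).
Qed.

Lemma SECI_finite : finite_set SECI.
Proof.
pose g (phi : filling s) : {fset cell s * nat} :=
  [fset (c, label phi c) | c in domf phi]%fset.
have g_inj : injective g.
  move=> phi psi e; apply/fmapP => c.
  have sub (p q : filling s) x : g p = g q -> x \in domf p -> p.[? x]%fmap = q.[? x]%fmap.
    move=> epq xp; have : (x, label p x) \in g q.
      by rewrite -epq; apply/imfsetP; exists x.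
    case/imfsetP=> y /= yq [exy]; rewrite -exy in yq *.
    by rewrite /label !in_fnd /= => ->.
  have [cp|cp] := boolP (c \in domf phi); first exact: sub.
  have [cq|cq] := boolP (c \in domf psi); first by rewrite (sub psi phi).
  by rewrite !not_fnd.
pose box : set (cell s) := dg `|`
  [set (i, - Posz m) | i in [set: 'I_s] & m in `I_n.+1].
have box_fin : finite_set box.
  rewrite finite_setU; split; first exact: dg_finite.
  by apply: finite_image2 => //; exact: finite_II.
have tgt_fin : finite_set (box `*` `I_n.+1) by apply: finite_setX.
pose X := fset_set (box `*` `I_n.+1).
have pre_fin : finite_set (g @^-1` [set` fpowerset X]).
  apply: finite_preimage; last exact: finite_fset.
  by move=> ? ? _ _; exact: g_inj.
apply: sub_finite_set pre_fin => phi [[b Db] size_D [lab_fun _ _] _].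
rewrite /= fpowersetE; apply/fsubsetP => _ /imfsetP[c /= cD ->].
rewrite in_fset_set // inE; split=> /=; last first.
  by case/andP: (lab_fun c cD).
have : cells phi c by [].
rewrite Db => -[|cB]; [by left | right].
case: c {cD} cB => i j /= /andP[/= bj j0].
exists i => //; exists `|j|%N; last by rewrite abszE ler0_norm // opprK.
rewrite /= ltnS leqNgt; apply/negP => lt_nj.
pose col : seq (cell s) := [seq (i, - Posz m) | m <- iota 0 n.+1].
have col_uniq : uniq col.
  by rewrite map_inj_uniq ?iota_uniq // => m m' [] /oppr_inj [].
have /(uniq_leq_size col_uniq) : {subset col <= enum_fset (domf phi)}.
  move=> _ /mapP[m + ->]; rewrite mem_iota /= ltnS => le_mn.
  suff : cells phi (i, - Posz m) by [].
  rewrite Db; right; rewrite /basement /= oppr_le0 andbT.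
  apply: lt_le_trans bj _; rewrite -[j]opprK lerN2 -ler0_norm // -abszE lez_nat.
  exact: leq_trans le_mn (ltnW lt_nj).
by rewrite size_map size_iota -[size _]/(#|` domf phi|) size_D ltnn.
Qed.

End Fillings.

Arguments SECI : clear implicits.

(* Main.v *)
Require Import Defs.
From mathcomp Require Import all_boot all_order all_algebra finmap mpoly.
From mathcomp Require Import boolp classical_sets functions cardinality fsbigop.
From mathcomp Require Import zify.

Set Implicit Arguments.
Unset Strict Implicit.
Unset Printing Implicit Defensive.

Import Order.TTheory GRing.Theory Num.Theory.

Local Open Scope classical_set_scope.
Local Open Scope ring_scope.

(** The proof compares three descriptions of the same numbers.

    Words. Recording the column of each label turns a column-increasing filling
    into a word [w] of length [n] in the columns, with at least [la_i] letters
    [i] ([word_filling_bij]): in each column the labels are read off from top to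
    bottom. Removing the labels in increasing order lowers the columns one by
    one. The pairs counted by the two statistics in which the cell of a given
    label is the smaller one are then indexed by the columns that are, at that
    moment, higher than the column of the label, ties being won by the column
    on the left ([dinv_word_stat], [inv_word_stat]). So each statistic is the sum
    over the labels of the rank of a column among all columns ordered by height;
    for [dinv] the heights may become negative, for [inv] the negative heights
    are replaced by zero. All that matters about this order is that it is a
    [ranking]: the [s] ranks are [0, ..., s-1], and taller columns come first,
    heights that are at most [0] being interchangeable.

    Upper bound. For any ranking, the monomials whose exponents are the
    successive ranks read along an admissible word span the quotient
    ([all_spanned]). This is an induction on [n]: if column [i] has rank [a], then
    multiplication by the [a]-th power of the last variable maps the ideal for
    [n-1] variables and heights lowered in column [i] into the ideal for [n]
    variables, modulo the next power of the last variable ([ideal_lower]). Since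
    the ideal is homogeneous, the monomials of degree [d] span the component of
    degree [d].

    Lower bound. A word is also a point with coordinates in [{0, ..., s-1}], and
    every generator of the ideal is the top homogeneous component of a polynomial
    that vanishes at the points of all admissible words ([comp_gens_top]): among
    the coordinates indexed by [S], the value [i] occurs at least
    [la_i - (n - #|S|)] times, so the product of the [1 + x_t T] over [S] is
    divisible by a fixed polynomial in [T] of degree [p], and the coefficients of
    the quotient beyond its degree are zero. Hence the monomials span all
    functions on the points. There are as many monomials as points, so the
    monomials are linearly independent on the points, and also modulo the ideal
    ([words_free], [homog_words_free]).

    Therefore the distribution of the statistic of every ranking is the Hilbert
    series. Applied to the two rankings above, this gives the first equality, and
    the second one because dimensions are unique. *)

(** * Elementary symmetric polynomials of a set of variables *)

Lemma finset_ind (T : finType) (P : {set T} -> Prop) :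
  P finset.set0 -> (forall x (S : {set T}), x \notin S -> P S -> P (x |: S)%SET) ->
  forall S, P S.
Proof.
move=> P0 PU S; move: {2}#|S| (erefl #|S|) => m.
elim: m S => [|m IHm] S; first by move/cards0_eq ->.
move=> cS; have [S0|[x xS]] := set_0Vmem S; first by rewrite S0.
rewrite -(finset.setD1K xS); apply: PU; first by rewrite !inE eqxx.
by apply: IHm; move: cS; rewrite (cardsD1 x) xS => -[].
Qed.

Section ElementarySymmetric.
Variable n : nat.
Implicit Types S : {set 'I_n}.

Lemma e_poly0 S : e_poly S 0 = 1.
Proof.
rewrite /e_poly (big_pred1 (@finset.set0 _)) ?finset.big_set0 // => T /=.
by rewrite cards_eq0; case: eqP => [->|]; rewrite ?finset.sub0set ?andbF.
Qed.

Lemma e_poly_set0 d : e_poly (finset.set0 : {set 'I_n}) d.+1 = 0.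
Proof.
rewrite /e_poly big_pred0 // => T; rewrite finset.subset0.
by case: eqP => // ->; rewrite cards0.
Qed.

Lemma e_polyU1 x S d : x \notin S ->
  e_poly (x |: S)%SET d.+1 = e_poly S d.+1 + 'X_x * e_poly S d.
Proof.
move=> xS; rewrite {1}/e_poly (bigID (fun T : {set 'I_n} => x \in T)) /= addrC.
congr (_ + _).
  apply: eq_bigl => T; rewrite -subDset.
  have [xT|xT] := boolP (x \in T) => /=; last first.
    by rewrite andbT (finset.setDidPl _) // disjoint_sym disjoints1.
  rewrite andbF; apply/esym/negbTE; rewrite negb_and; apply/orP; left.
  by apply: contraNN xS => /fintype.subsetP /(_ x xT).
rewrite /e_poly mulr_sumr.
rewrite (reindex_onto (fun U : {set 'I_n} => x |: U)%SET
                      (fun T : {set 'I_n} => T :\ x)%SET) /=; last first.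
  by move=> T /andP[_ xT]; rewrite finset.setD1K.
apply: eq_big => [U|U].
  rewrite setU11 andbT.
  have [xU|xU] := boolP (x \in U).
    rewrite [LHS](_ : _ = false).
      apply/esym/negbTE; rewrite negb_and; apply/orP; left.
      by apply: contraNN xS => /fintype.subsetP /(_ x xU).
    apply/negP => /andP[_ /eqP eU]; move: xU; rewrite -eU.
    by rewrite !inE eqxx.
  by rewrite cardsU1 xU add1n eqSS finset.setU1K // eqxx andbT -subDset finset.setU1K.
rewrite setU11 andbT => /andP[_ /eqP eU].
rewrite finset.big_setU1 //; rewrite -eU; by rewrite !inE eqxx.
Qed.

Lemma e_poly_homog S d : e_poly S d \is d.-homog.
Proof.
apply: rpred_sum => T /andP[_ /eqP <-].
rewrite mprodXE dhomogX /= mdeg_sum.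
by rewrite (eq_bigr (fun _ => 1%N)) ?sum1_card // => i _; rewrite mdeg1.
Qed.

(** The generating function of the values of the [e_d(S)] at a point. *)
Lemma coef_prod_e_poly (v : 'I_n -> rat) S d :
  (\prod_(i in S) (1 + v i *: 'X : {poly rat}))`_d = (e_poly S d).@[v].
Proof.
elim/finset_ind: S d => [|x S xS IHS] d.
  rewrite finset.big_set0 coef1; case: d => [|d] /=; first by rewrite e_poly0 meval1.
  by rewrite e_poly_set0 meval0.
rewrite finset.big_setU1 //= mulrDl mul1r coefD -scalerAl coefZ coefXM IHS.
case: d => [|d] /=; first by rewrite mulr0 addr0 !e_poly0.
by rewrite e_polyU1 // mevalD mevalM mevalXU IHS.
Qed.

End ElementarySymmetric.

Local Notation wid := (widen_ord (leqnSn _)).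

Lemma mwiden_U n (i : 'I_n) : mwiden ('X_i : {mpoly rat[n]}) = 'X_(wid i).
Proof. by rewrite mwidenX mnmwiden1. Qed.

Lemma wid_max n (S : {set 'I_n}) : ord_max \notin [set wid i | i in S]%SET.
Proof.
apply/imsetP => -[i _ /(congr1 val) /= e]; by have := ltn_ord i; rewrite -e ltnn.
Qed.

Lemma wid_inj n : injective (widen_ord (leqnSn n)).
Proof. by move=> i j /(congr1 val) /= e; apply: val_inj. Qed.

Lemma mwiden_e_poly n (S : {set 'I_n}) d :
  mwiden (e_poly S d) = e_poly [set wid i | i in S]%SET d.
Proof.
elim/finset_ind: S d => [|x S xS IHS] [|d]; rewrite ?e_poly0 ?mwiden1 //.
  by rewrite finset.imset0 !e_poly_set0 mwiden0.
have wxS : wid x \notin [set wid i | i in S]%SET.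
  by rewrite (finset.mem_imset _ _ (@wid_inj n)).
rewrite finset.imsetU1 !e_polyU1 // mwidenD mwidenM mwiden_U !IHS //.
Qed.

(** * Generated ideals *)

Section Ideals.
Variables (n : nat) (G : set {mpoly rat[n]}).

Lemma ideal_gen_gen g : G g -> g \in ideal_gen G.
Proof.
move=> Gg; apply/asboolP; exists [:: (1, g)]; split.
  by move=> u; rewrite inE => /eqP ->.
by rewrite big_seq1 mul1r.
Qed.

Lemma ideal_gen_ind (P : {mpoly rat[n]} -> Prop) :
  P 0 -> (forall f g, P f -> P g -> P (f + g)) ->
  (forall f g, G g -> P (f * g)) -> forall f, f \in ideal_gen G -> P f.
Proof.
move=> P0 PD PM f /asboolP[t [Gt ->]]; elim: t Gt => [|u t IHt] Gt.
  by rewrite big_nil.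
rewrite big_cons; apply: PD; first by apply: PM; apply: Gt; rewrite mem_head.
by apply: IHt => v vt; apply: Gt; rewrite inE vt orbT.
Qed.

Lemma mpoly_ind_monom (P : {mpoly rat[n]} -> Prop) :
  P 0 -> (forall f g, P f -> P g -> P (f + g)) ->
  (forall c m, P (c *: 'X_[m])) -> forall f, P f.
Proof.
move=> P0 PD PX; elim/mpolyind => // c m p _ _ Pp; apply: PD => //.
Qed.

(** A homogeneous component of an element of an ideal with homogeneous
    generators is a sum of homogeneous multiples of the generators. *)
Lemma pihomog_ideal_ind (d : nat) (P : {mpoly rat[n]} -> Prop) :
  P 0 -> (forall f g, P f -> P g -> P (f + g)) ->
  (forall c m g e, G g -> g \is e.-homog -> (mdeg m + e)%N = d ->
     P (c *: 'X_[m] * g)) ->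
  (forall g, G g -> exists e, g \is e.-homog) ->
  forall f, f \in ideal_gen G -> P (pihomog mdeg d f).
Proof.
move=> P0 PD PM hG; apply: ideal_gen_ind => [|f g Pf Pg|f g Gg].
- by rewrite pihomog0.
- by rewrite pihomogD; apply: PD.
elim/mpoly_ind_monom: f => [|f h Pf Ph|c m].
- by rewrite mul0r pihomog0.
- by rewrite mulrDl pihomogD; apply: PD.
have [e ge] := hG _ Gg.
have hm : c *: 'X_[m] * g \is (mdeg m + e).-homog.
  by apply: dhomogM => //; apply: dhomogZ; rewrite dhomogX.
have [ed|ed] := eqVneq (mdeg m + e)%N d.
  by rewrite pihomog_dE -?ed //; apply: PM Gg ge ed.
by rewrite (pihomog_ne0 ed).
Qed.

Lemma ideal_pihomog (d : nat) f :
  (forall g, G g -> exists e, g \is e.-homog) ->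
  f \in ideal_gen G -> pihomog mdeg d f \in ideal_gen G.
Proof.
move=> hG; apply: (pihomog_ideal_ind (P := fun g => g \in ideal_gen G)) => //.
  exact: rpred0.
  by move=> ? ? ? ?; exact: rpredD.
by move=> c m g e Gg _ _; apply: ideal_genMr; apply: ideal_gen_gen.
Qed.

End Ideals.

(** * Compositions, rankings of columns and standard monomials *)

(** The positive part of an integer. *)
Definition pospart (x : int) : nat := if x is Posz p then p else 0%N.

Lemma pospart_spec (x : int) :
  x <= 0 /\ pospart x = 0%N \/ 0 <= x /\ (pospart x)%:Z = x.
Proof. by case: x => p; [right | left]; split => //=; lia. Qed.

Section Compositions.
Variable s : nat.
Implicit Types (al : 'I_s -> int) (i : 'I_s) (w : seq 'I_s).

(** The number of cells in rows above [c] of the diagram whose [i]-th column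
    reaches up to row [al i]. *)
Definition excess al (c : nat) : nat := (\sum_i (pospart (al i) - c))%N.

(** Lowering the top of column [i] by one row. *)
Definition lower al i : 'I_s -> int := fun j => al j - (j == i)%:Z.

(** Words with at least [al i] occurrences of each letter [i]. *)
Definition admissible al w : bool := [forall i, al i <= (count_mem i w)%:Z].

Lemma admissible_cons al i w : admissible al (i :: w) = admissible (lower al i) w.
Proof.
by apply: eq_forallb => j /=; rewrite /lower lerBlDr PoszD addrC eq_sym.
Qed.

Lemma excessS al c : excess al c = (excess al c.+1 + #|[set j | (c%:Z < al j)%R]%SET|)%N.
Proof.
have -> : #|[set j | (c%:Z < al j)%R]%SET| = (\sum_j (c%:Z < al j)%R)%N.
  by rewrite -sum1dep_card big_mkcond /=; apply: eq_bigr => j _; case: ifP.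
rewrite /excess -big_split /=; apply: eq_bigr => i _; rewrite /pospart.
by case: (al i) => p; lia.
Qed.

Lemma excess_lower al i c :
  (excess (lower al i) c + (c%:Z < al i)%R)%N = excess al c.
Proof.
rewrite /excess (bigD1 i) //= [RHS](bigD1 i) //= addnAC; congr (_ + _)%N.
  rewrite /lower eqxx [X in al i - X](_ : _ = 1) //.
  have := pospart_spec (al i); have := pospart_spec (al i - 1).
  case: (ltP c%:Z (al i)) => /=;
    by move: (al i) (pospart (al i)) (pospart (al i - 1)) => x y z; lia.
by apply: eq_bigr => j /negbTE ji; rewrite /lower ji subr0.
Qed.

(** Powers of the variables and the [e_d(S)] with
    [d > #|S| - excess al (n - #|S|)]; here [d = 0] is allowed, so that the
    ideal is the whole ring when [al] does not fit in [n] cells. *)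
Definition comp_gens n al : set {mpoly rat[n]} :=
  [set 'X_i ^+ s | i in [set: 'I_n]] `|`
  [set f | exists (S : {set 'I_n}) (d : nat),
     (#|S| < d + excess al (n - #|S|))%N /\ f = e_poly S d].

Lemma comp_gens_homog n al g :
  comp_gens (n := n) al g -> exists e, g \is e.-homog.
Proof.
case=> [[i _ <-]|[S [d [_ ->]]]]; last by exists d; exact: e_poly_homog.
exists (1 * s)%N; apply: dhomogMn; rewrite dhomogX /=; by rewrite mdeg1.
Qed.

(** [r al] numbers the columns from [0] to [s - 1] in such a way that, for every
    [c >= 0], the columns higher than [c] come before the other ones. *)
Definition ranking (r : ('I_s -> int) -> 'I_s -> nat) : Prop :=
  [/\ forall al i, (r al i < s)%N,
      forall al a, (a < s)%N -> exists i, r al i = a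
    & forall al i (c : nat), al i <= c%:Z ->
        (#|[set j | (c%:Z < al j)%R]%SET| <= r al i)%N].

Variable r : ('I_s -> int) -> 'I_s -> nat.

(** The monomial attached to a word of length [n]: the exponents are the ranks of
    the letters, each taken after the columns of the preceding letters have been
    lowered; the first letter goes with the last variable. *)
Fixpoint word_monom n al w : {mpoly rat[n]} :=
  match n with
  | 0 => 1
  | n'.+1 => if w is i :: w' then
      'X_ord_max ^+ r al i * mwiden (word_monom n' (lower al i) w') else 0
  end.

(** The degree of the monomial attached to a word. *)
Fixpoint word_stat al w : nat :=
  if w is i :: w' then (r al i + word_stat (lower al i) w')%N else 0%N.

Lemma mwiden_homog n (p : {mpoly rat[n]}) d : p \is d.-homog -> mwiden p \is d.-homog.
Proof.
move/dhomogP => hp; rewrite (mwidenE (leqnn _)).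
apply: rpred_sum => m _; have [pm|pm] := boolP (bmnm m \in msupp p); last first.
  by rewrite memN_msupp_eq0 // scale0r rpred0.
apply: dhomogZ; rewrite dhomogX /=; apply/eqP; rewrite -(hp _ pm) !mdegE.
rewrite big_ord_recr /= mnmwiden_ordmax addn0 mdegE.
by apply: eq_bigr => i _; rewrite mnmwiden_widen.
Qed.

Lemma word_monom_homog n al w :
  size w = n -> word_monom n al w \is (word_stat al w).-homog.
Proof.
elim: n al w => [|n IHn] al [|i w] //= => [_|[sw]]; first exact: dhomog1.
apply: dhomogM; last by apply: mwiden_homog; exact: IHn.
by rewrite -[X in X.-homog]mul1n; apply: dhomogMn; rewrite dhomogX /= mdeg1.
Qed.

Hypothesis rP : ranking r.

(** * The monomials of admissible words span the quotient *)

Local Notation xl := ('X_ord_max).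

(** Eliminating [x] from the relations
    [e_(j+1)(x, S) = e_(j+1)(S) + x e_j(S)]. *)
Lemma e_poly_chain n (I : zmodClosed {mpoly rat[n.+1]})
    (IM : forall f g, g \in I -> f * g \in I) (x : 'I_n.+1) (S : {set 'I_n.+1}) c d :
  x \notin S -> (forall j, (d < j <= d + c)%N -> e_poly (x |: S)%SET j \in I) ->
  e_poly S (d + c) \in I -> 'X_x ^+ c * e_poly S d \in I.
Proof.
move=> xS; elim: c d => [|c IHc] d HI Hc; first by rewrite expr0 mul1r -[d]addn0.
rewrite exprSr -mulrA.
have -> : 'X_x * e_poly S d = e_poly (x |: S)%SET d.+1 - e_poly S d.+1.
  by rewrite e_polyU1 // addrC addKr.
rewrite mulrBr rpredB //; first by apply: IM; apply: HI; lia.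
by apply: IHc => [j hj|]; [apply: HI; lia | rewrite addSnnS].
Qed.

(** Multiplying by the power of the last variable that is the rank of column
    [i] carries the ideal for [lower al i] into the ideal for [al], up to a
    higher power of the last variable. *)
Lemma ideal_lower n al i u : u \in ideal_gen (comp_gens (n := n) (lower al i)) ->
  exists v, xl ^+ r al i * mwiden u - xl ^+ (r al i).+1 * v
            \in ideal_gen (comp_gens (n := n.+1) al).
Proof.
case: rP => _ _ rge; move: u; set I := ideal_gen (comp_gens (n := n.+1) al).
apply: ideal_gen_ind => [|f g [v Hv] [v' Hv']|f g].
- by exists 0; rewrite mwiden0 !mulr0 subr0 rpred0.
- exists (v + v'); rewrite mwidenD !mulrDr opprD addrACA; exact: rpredD.
suff H : comp_gens (n := n) (lower al i) g ->
    exists v, xl ^+ r al i * mwiden g - xl ^+ (r al i).+1 * v \in I.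
  case/H => v Hv; exists (mwiden f * v); rewrite mwidenM.
  by rewrite mulrCA [xl ^+ _ * (_ * _)]mulrCA -mulrBr; exact: ideal_genMr.
case=> [[j _ <-]|[S [d [hd ->]]]].
  exists 0; rewrite mulr0 subr0; apply: ideal_genMr; apply: ideal_gen_gen; left.
  by exists (wid j) => //; rewrite rmorphXn /= mwiden_U.
have := excess_lower al i (n - #|S|); have := excessS al (n - #|S|).
rewrite mwiden_e_poly; set T := [set wid i | i in S]%SET.
have mT : ord_max \notin T by exact: wid_max.
have cT : #|T| = #|S| by rewrite card_imset //; exact: wid_inj.
have leS : (#|S| <= n)%N by rewrite -[X in (_ <= X)%N]card_ord max_card.
have IT e : (#|S| < e + excess al (n - #|S|).+1)%N -> e_poly T e \in I.
  move=> he; apply: ideal_gen_gen; right; exists T, e; split=> //.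
  by rewrite cT subSn.
have IxT e : (#|S|.+1 < e + excess al (n - #|S|))%N -> e_poly (ord_max |: T)%SET e \in I.
  move=> he; apply: ideal_gen_gen; right; exists (ord_max |: T)%SET, e; split=> //.
  by rewrite cardsU1 mT cT add1n subSS.
set c := #|[set j | _]%SET|.
have [lt_c|ge_c] := ltP (n - #|S|)%:Z (al i) => eS el.
  (* column [i] is high: [e_d(T) = e_d(x, T) - x e_(d-1)(T)] with [e_d(x, T)] in [I] *)
  case: d => [|d] in hd *.
    by exists 0; rewrite mulr0 subr0; apply: ideal_genMr; rewrite e_poly0
      -(e_poly0 (ord_max |: T)%SET); apply: IxT; lia.
  exists (- e_poly T d); rewrite exprSr -mulrA -mulrBr; apply: ideal_genMr.
  by rewrite mulrN opprK -e_polyU1 //; apply: IxT; lia.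
(* column [i] is low, so that its rank is at least the number [c] of high columns *)
exists 0; rewrite mulr0 subr0.
have le_cr : (c <= r al i)%N by apply: rge.
rewrite -(subnK le_cr) exprD -mulrA; apply: ideal_genMr.
apply: (e_poly_chain (I := ideal_gen (comp_gens (n := n.+1) al))) => //.
- exact: ideal_genMr.
- by move=> j hj; apply: IxT; lia.
- by apply: IT; lia.
Qed.

Lemma mpoly_wid_split n (f : {mpoly rat[n.+1]}) :
  exists g h, f = mwiden g + xl * h.
Proof.
elim/mpoly_ind_monom: f => [|f f' [g [h ->]] [g' [h' ->]]|c m].
- by exists 0, 0; rewrite mwiden0 mulr0 addr0.
- by exists (g + g'), (h + h'); rewrite mwidenD mulrDr addrACA.
rewrite mpolyXE_id big_ord_recr /=.
set p := \prod_(i < n) _; have [q ->] : exists q, p = mwiden q.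
  exists (\prod_(i < n) 'X_i ^+ m (wid i)); rewrite rmorph_prod.
  by apply: eq_bigr => j _; rewrite rmorphXn /= mwiden_U.
case: (m ord_max) => [|a].
  by exists (c *: q), 0; rewrite mwidenZ expr0 mulr1 mulr0 addr0.
exists 0, (c *: (mwiden q * xl ^+ a)); rewrite mwiden0 add0r exprS.
by rewrite -scalerAr mulrCA.
Qed.

(** Membership in the sum of the ideal and the span of the monomials of
    admissible words. *)
Definition spanned n al (f : {mpoly rat[n]}) : Prop :=
  exists c : n.-tuple 'I_s -> rat,
    f - \sum_(w : n.-tuple 'I_s | admissible al w) c w *: word_monom n al w
      \in ideal_gen (comp_gens (n := n) al).

Lemma spannedD n al (f g : {mpoly rat[n]}) :
  spanned al f -> spanned al g -> spanned al (f + g).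
Proof.
case=> c Hc [c' Hc']; exists (fun w : n.-tuple 'I_s => c w + c' w).
under eq_bigr do rewrite scalerDl.
by rewrite big_split /= opprD addrACA rpredD.
Qed.

Lemma spanned_ideal n al (f : {mpoly rat[n]}) :
  f \in ideal_gen (comp_gens (n := n) al) -> spanned al f.
Proof.
by exists (fun=> 0); rewrite big1 ?subr0 // => w _; rewrite scale0r.
Qed.

Lemma spannedZ n al a (f : {mpoly rat[n]}) : spanned al f -> spanned al (a *: f).
Proof.
case=> c Hc; exists (fun w : n.-tuple 'I_s => a * c w).
under eq_bigr do rewrite -scalerA.
by rewrite -scaler_sumr -scalerBr -mul_mpolyC; apply: ideal_genMr.
Qed.

Lemma spanned_sum n al (J : Type) (t : seq J) (P : pred J) (F : J -> {mpoly rat[n]}) :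
  (forall j, P j -> spanned al (F j)) -> spanned al (\sum_(j <- t | P j) F j).
Proof.
move=> H; elim/big_ind: _ => //; last exact: spannedD.
by apply: spanned_ideal; exact: rpred0.
Qed.

Lemma spanned_word n al (w : n.-tuple 'I_s) :
  admissible al w -> spanned al (word_monom n al w).
Proof.
move=> aw; exists (fun w' : n.-tuple 'I_s => (w' == w)%:R).
rewrite (bigD1 w) //= eqxx scale1r.
rewrite big1 ?addr0 ?subrr ?rpred0 // => w' /andP[_ /negbTE ->].
by rewrite scale0r.
Qed.

Lemma mpoly0_scale (f : {mpoly rat[0]}) : exists c, f = c *: 1.
Proof.
elim/mpoly_ind_monom: f => [|f f' [c ->] [c' ->]|c m].
- by exists 0; rewrite scale0r.
- by exists (c + c'); rewrite scalerDl.
by exists c; rewrite mpolyXE_id big_ord0.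
Qed.

Lemma all_spanned n al (f : {mpoly rat[n]}) : spanned al f.
Proof.
case: (rP) => _ rsurj _; elim: n al f => [|n IHn] al f.
  have [c ->] := mpoly0_scale f; apply: spannedZ.
  have [a0|a0] := boolP (admissible al [::]).
    exact: (spanned_word (w := [tuple])).
  apply: spanned_ideal; apply: ideal_gen_gen; right; exists finset.set0, 0%N.
  rewrite e_poly0; split=> //; rewrite cards0 add0n lt0n.
  apply: contraNneq a0 => /eqP; rewrite sum_nat_eq0 => /forallP a0.
  by apply/forallP => i; have := a0 i; rewrite /= subn0 /pospart; case: (al i); lia.
(* descending induction on the power of the last variable, whose [s]-th power
   is in the ideal *)
suff H b a (g : {mpoly rat[n.+1]}) : (a + b = s)%N -> spanned al (xl ^+ a * g).
  by have := H s 0%N f; rewrite expr0 mul1r; apply.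
elim: b a g => [|b IHb] a g eab.
  apply: spanned_ideal; rewrite mulrC; apply: ideal_genMr; apply: ideal_gen_gen.
  by left; exists ord_max; rewrite -?eab ?addn0.
have [g0 [g1 ->]] := mpoly_wid_split g; rewrite mulrDr; apply: spannedD; last first.
  by rewrite mulrA -exprSr; apply: IHb; rewrite addSnnS.
have [|i ri] := rsurj al a; first by rewrite -eab; lia.
have [c Hc] := IHn (lower al i) g0.
have [v Hv] := ideal_lower Hc; rewrite ri in Hv.
set u := \sum_(w | _) _ in Hv.
have -> : xl ^+ a * mwiden g0 =
  (xl ^+ a * mwiden (g0 - u) - xl ^+ a.+1 * v) + xl ^+ a.+1 * v + xl ^+ a * mwiden u.
  by rewrite subrK -mulrDr -mwidenD subrK.
apply: spannedD; first apply: spannedD; first exact: spanned_ideal.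
  by apply: IHb; rewrite addSnnS.
rewrite raddf_sum mulr_sumr; apply: spanned_sum => w aw.
rewrite /= mwidenZ -scalerAr; apply: spannedZ.
have := @spanned_word n.+1 al [tuple of i :: w].
by rewrite /= ri; apply; rewrite admissible_cons.
Qed.

End Compositions.

(** * Polynomials of small degree *)

Section SmallDegree.
Variable n : nat.
Implicit Types p q : {mpoly rat[n]}.

Lemma msize_leD d p q : (msize p <= d)%N -> (msize q <= d)%N -> (msize (p + q) <= d)%N.
Proof.
by move=> hp hq; apply: leq_trans (mmeasureD_le _ _ _) _; rewrite geq_max hp.
Qed.

Lemma msize_leZ d c p : (msize p <= d)%N -> (msize (c *: p) <= d)%N.
Proof. by apply: leq_trans; exact: msizeZ_le. Qed.

Lemma msize_le_sum d (J : Type) (t : seq J) (P : pred J) (F : J -> {mpoly rat[n]}) :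
  (forall j, P j -> msize (F j) <= d)%N -> (msize (\sum_(j <- t | P j) F j) <= d)%N.
Proof.
move=> H; elim/big_ind: _ => //; first by rewrite msize0.
exact: msize_leD.
Qed.

Lemma msize_leM a b p q :
  (msize p <= a)%N -> (msize q <= b.+1)%N -> (msize (p * q) <= a + b)%N.
Proof.
move=> hp hq; have [->|p0] := eqVneq p 0; first by rewrite mul0r msize0.
have [->|q0] := eqVneq q 0; first by rewrite mulr0 msize0.
rewrite msizeM //; move: (mmeasure _ p) (mmeasure _ q) hp hq => x y; lia.
Qed.

Lemma msize_homog d p : p \is d.-homog -> (msize p <= d.+1)%N.
Proof.
move=> /dhomogP hp; rewrite msizeE; apply/bigmax_leqP_seq => m mp _.
by rewrite ltnS hp.
Qed.

Lemma msize_sub_pihomog d p :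
  (msize p <= d.+1)%N -> (msize (p - pihomog mdeg d p) <= d)%N.
Proof.
move=> hp; rewrite {1}(pihomog_partitionE hp) big_ord_recr /= addrK.
apply: msize_le_sum => k _; apply: leq_trans (ltn_ord k).
by apply: msize_homog; exact: pihomogP.
Qed.

(** [X^m - (X - c_0) ... (X - c_(m-1))] has degree less than [m]. *)
Lemma msize_Xn_sub_prod i (c : nat -> rat) m :
  (msize ('X_i ^+ m - \prod_(j < m) ('X_i - (c j)%:MP) : {mpoly rat[n]}) <= m)%N.
Proof.
have hX : ('X_i : {mpoly rat[n]}) \is 1.-homog by rewrite dhomogX /= mdeg1.
elim: m => [|m IHm]; first by rewrite big_ord0 subrr msize0.
rewrite big_ord_recr /=; set p := \prod_(j < m) _ in IHm *.
have -> : 'X_i ^+ m.+1 - p * ('X_i - (c m)%:MP) =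
  ('X_i ^+ m - p) * ('X_i - (c m)%:MP) + (c m) *: 'X_i ^+ m.
  rewrite mulrBl ['X_i ^+ m * (_ - _)]mulrBr exprSr -mul_mpolyC [_%:MP * _]mulrC.
  by rewrite [RHS]addrAC subrK.
apply: msize_leD.
  rewrite -[m.+1]addn1; apply: msize_leM => //; apply: msize_leD.
    exact: msize_homog hX.
  by rewrite -mpolyCN msizeC; case: (_ == _).
apply: msize_leZ; apply: msize_homog.
by rewrite -[X in X.-homog]mul1n; exact: dhomogMn.
Qed.

End SmallDegree.

(** * Truncated inverses of polynomials *)

Lemma poly_trunc_inverse (h : {poly rat}) N : h`_0 = 1 ->
  exists g : {poly rat}, forall k, (k < N)%N -> (g * h)`_k = (k == 0%N)%:R.
Proof.
move=> h0; have [q hq] : exists q, h - 1 = 'X * q.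
  have : root (h - 1) 0 by rewrite /root hornerD hornerN hornerC horner_coef0 h0 subrr.
  by case/factor_theorem => q ->; exists q; rewrite subr0 mulrC.
exists (\sum_(i < N) (1 - h) ^+ i) => k kN.
have -> : (\sum_(i < N) (1 - h) ^+ i) * h = 1 - (1 - h) ^+ N.
  by rewrite -[RHS]opprB subrX1 -mulNr opprB subKr mulrC.
have -> : 1 - h = 'X * - q by rewrite mulrN -hq opprB.
by rewrite exprMn coefB coef1 coefXnM kN subr0.
Qed.

Lemma size_linear_exp (a : rat) m : (size ((1 + a *: 'X : {poly rat}) ^+ m) <= m.+1)%N.
Proof.
have s1 : (size (1 + a *: 'X : {poly rat})%R <= 2)%N.
  apply: leq_trans (size_polyD _ _) _; rewrite size_poly1 geq_max /=.
  by apply: leq_trans (size_scale_leq _ _) _; rewrite size_polyX.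
elim: m => [|m IHm]; first by rewrite expr0 size_poly1.
by rewrite exprS; apply: leq_trans (size_polyMleq _ _) _; lia.
Qed.

Lemma size_prod_linear_exp s (a : 'I_s -> rat) (m : 'I_s -> nat) :
  (size (\prod_i (1 + a i *: 'X : {poly rat}) ^+ m i)%R <= (\sum_i m i).+1)%N.
Proof.
elim/big_ind2: _ => [|b p c q hp hq|i _]; first by rewrite size_poly1.
  by apply: leq_trans (size_polyMleq _ _) _; lia.
exact: size_linear_exp.
Qed.

(** * The points attached to admissible words *)

Section Points.
Variables (n s : nat) (al : 'I_s -> int).
Implicit Types w : n.-tuple 'I_s.

(** The coordinates of the point attached to a word are its letters. *)
Definition word_point w : 'I_n -> rat := fun t => (tnth w t : nat)%:R.

Lemma count_mem_tuple i w : count_mem i w = #|[set t | tnth w t == i]%SET|.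
Proof.
by rewrite -[X in count_mem i X]map_tnth_enum count_map cardsE cardE -size_filter enumT.
Qed.

(** At most [n - #|S|] of the letters [i] lie outside of [S]. *)
Lemma admissible_mult w (S : {set 'I_n}) i : admissible al w ->
  (pospart (al i) - (n - #|S|) <= #|[set t in S | tnth w t == i]%SET|)%N.
Proof.
move=> /forallP /(_ i); rewrite count_mem_tuple.
have := cardsC S; rewrite card_ord.
have : (#|[set t | tnth w t == i]%SET| <=
        #|[set t in S | tnth w t == i]%SET| + #|(~: S)%SET|)%N.
  apply: leq_trans (leq_card_setU _ _); apply: subset_leq_card.
  by apply/fintype.subsetP => t; rewrite !inE => ->; case: (t \in S).
have := pospart_spec (al i); move: (al i) (pospart _) => x y.
by move: #|_| #|_| #|_| #|_| => a b c d; lia.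
Qed.

(** Vanishing at the points of all admissible words. *)
Definition vanishes (f : {mpoly rat[n]}) : Prop :=
  forall w, admissible al w -> f.@[word_point w] = 0.

(** Every generator of the ideal is the top component of a polynomial that
    vanishes at all the points. *)
Lemma comp_gens_top g : comp_gens (n := n) al g ->
  exists e g', [/\ g \is e.-homog, (msize g' <= e)%N & vanishes (g - g')].
Proof.
case=> {g} [[i _ <-]|[S [d [hd ->]]]].
  exists s, ('X_i ^+ s - \prod_(j < s) ('X_i - (j%:R)%:MP)); split.
  - by rewrite -[X in X.-homog]mul1n; apply: dhomogMn; rewrite dhomogX /= mdeg1.
  - exact: (msize_Xn_sub_prod i (fun j => j%:R)).
  move=> w _; rewrite subKr rmorph_prod (bigD1 (tnth w i)) //=.
  by rewrite mevalB mevalXU mevalC subrr mul0r.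
(* [h] divides the product [F] of the [1 + x_t T] over [S] at every point, and
   [g] is its inverse modulo [T^(d+1)] *)
pose m i := (pospart (al i) - (n - #|S|))%N.
pose h : {poly rat} := \prod_(i < s) (1 + i%:R *: 'X) ^+ m i.
have h0 : h`_0 = 1.
  rewrite -horner_coef0 horner_prod big1 // => i _.
  by rewrite horner_exp hornerD hornerZ hornerX hornerC mulr0 addr0 expr1n.
have [g hg] := @poly_trunc_inverse h d.+1 h0.
exists d, (- \sum_(l < d) g`_l.+1 *: e_poly S (d - l.+1)); split.
- exact: e_poly_homog.
- rewrite msizeN; apply: msize_le_sum => l _; apply: msize_leZ.
  by apply: leq_trans (msize_homog (e_poly_homog _ _)) _; have := ltn_ord l; lia.
move=> w aw.
pose k i := #|[set t in S | tnth w t == i]%SET|.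
pose q : {poly rat} := \prod_(i < s) (1 + i%:R *: 'X) ^+ (k i - m i).
pose F : {poly rat} := \prod_(t in S) (1 + word_point w t *: 'X).
have hF : F = h * q.
  rewrite /F (partition_big (fun t => tnth w t) predT) //= -big_split /=.
  apply: eq_bigr => i _; rewrite -exprD subnKC; last exact: admissible_mult.
  rewrite -prodr_const; apply: eq_big => [t|t /andP[_ /eqP e]]; first by rewrite inE.
  by rewrite /word_point e.
have sk : (\sum_i k i)%N = #|S|.
  rewrite -sum1_card (partition_big (fun t => tnth w t) predT) //=.
  by apply: eq_bigr => i _; rewrite /k -sum1dep_card.
have sm : (\sum_i (k i - m i))%N = (#|S| - excess al (n - #|S|))%N.
  rewrite sumnB => [|i _]; last exact: admissible_mult.
  by rewrite sk.
have g0 : g`_0 = 1.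
  by have := hg 0%N isT; rewrite coef0M h0 mulr1.
rewrite opprK mevalD [X in _ + X]raddf_sum /=.
have -> : (e_poly S d).@[word_point w] +
   \sum_(l < d) (g`_l.+1 *: e_poly S (d - l.+1)).@[word_point w]
   = (g * F)`_d.
  rewrite coefM big_ord_recl /= g0 mul1r subn0 coef_prod_e_poly; congr (_ + _).
  by apply: eq_bigr => l _; rewrite mevalZ coef_prod_e_poly /=.
rewrite hF mulrA coefM big1 // => l _.
case: (posnP l) => [l0|l0]; last by rewrite hg ?(gtn_eqF l0) ?mul0r.
rewrite l0 subn0 [q`_d]nth_default ?mulr0 //.
apply: leq_trans (size_prod_linear_exp (fun i : 'I_s => i%:R) _) _; rewrite sm.
have : (excess al (n - #|S|) <= #|S|)%N.
  by rewrite -[X in (_ <= X)%N]sk; apply: leq_sum => i _; exact: admissible_mult.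
move: hd; lia.
Qed.

End Points.

(** * The monomials of admissible words are a homogeneous basis *)

Section Basis.
Variables (n s : nat) (al : 'I_s -> int) (r : ('I_s -> int) -> 'I_s -> nat).
Hypothesis rP : ranking r.
Implicit Types (w : n.-tuple 'I_s) (f : {mpoly rat[n]}).

Local Notation mon w := (word_monom r n al w).
Local Notation stat w := (word_stat r al w).
Local Notation ideal := (ideal_gen (comp_gens (n := n) al)).

Lemma mon_homog w : mon w \is (stat w).-homog.
Proof. by apply: word_monom_homog; rewrite size_tuple. Qed.

Lemma pihomog_words (c : n.-tuple 'I_s -> rat) d :
  pihomog mdeg d (\sum_(w : n.-tuple 'I_s | admissible al w) c w *: mon w) =
  \sum_(w : n.-tuple 'I_s | admissible al w && (stat w == d)) c w *: mon w.
Proof.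
rewrite raddf_sum [RHS]big_mkcondr /=; apply: eq_bigr => w _.
have hm : c w *: mon w \is (stat w).-homog by apply: dhomogZ; exact: mon_homog.
case: eqP => [<-|/eqP ne]; first by rewrite pihomog_dE.
by rewrite (pihomog_ne0 ne).
Qed.

Lemma homog_spanned d f : f \is d.-homog -> exists c : n.-tuple 'I_s -> rat,
  f - \sum_(w : n.-tuple 'I_s | admissible al w && (stat w == d)) c w *: mon w
    \in ideal.
Proof.
move=> hf; have [c Hc] := all_spanned rP al f; exists c.
have := ideal_pihomog d (@comp_gens_homog s n al) Hc.
by rewrite pihomogB pihomog_words pihomog_dE.
Qed.

(** On the points, the component of degree [d] of an element of the ideal agrees
    with a polynomial of degree less than [d]. *)
Lemma ideal_lower_on_points d f : f \in ideal ->
  exists f', (msize f' <= d)%N /\ vanishes al (pihomog mdeg d f - f').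
Proof.
pose P g := exists f', (msize f' <= d)%N /\ vanishes al (g - f').
apply: (@pihomog_ideal_ind _ _ d P); last exact: comp_gens_homog.
- by exists 0; rewrite msize0 subrr; split=> // w _; rewrite meval0.
- move=> g h [g' [sg vg]] [h' [sh vh]]; exists (g' + h'); split; first exact: msize_leD.
  by move=> w aw; rewrite opprD addrACA mevalD vg // vh // addr0.
move=> c m g e Gg ge hd.
have [g0|g0] := eqVneq g 0.
  by exists 0; rewrite g0 mulr0 msize0 subrr; split=> // w _; rewrite meval0.
have [e' [g' [ge' sg' vg']]] := comp_gens_top Gg.
rewrite -{e' ge'}(dhomog_uniq g0 ge ge') in sg'.
exists (c *: 'X_[m] * g'); split.
  rewrite -hd addnC mulrC; apply: msize_leM => //.
  by apply: msize_leZ; rewrite msizeX.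
by move=> w aw; rewrite -mulrBr mevalM vg' // mulr0.
Qed.

(** On the points, the monomials of degree less than [d] suffice for the
    polynomials of degree less than [d]. *)
Lemma eval_words d f : (msize f <= d)%N ->
  exists c : n.-tuple 'I_s -> rat, forall w, admissible al w ->
  f.@[word_point w] = \sum_(v : n.-tuple 'I_s | admissible al v && (stat v < d)%N)
                         c v * (mon v).@[word_point w].
Proof.
elim: d f => [|d IHd] f sf.
  exists (fun=> 0) => w _; move: sf; rewrite leqn0 msize_poly_eq0 => /eqP ->.
  by rewrite meval0 big1 // => v _; rewrite mul0r.
have [c Hc] := all_spanned rP al f.
have [f' [sf' vf']] := ideal_lower_on_points d Hc.
have /IHd[c' Hc'] : (msize (f - pihomog mdeg d f + f') <= d)%N.
  by apply: msize_leD => //; exact: msize_sub_pihomog.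
exists (fun v : n.-tuple 'I_s => if stat v == d then c v else c' v) => w aw.
rewrite (bigID (fun v : n.-tuple 'I_s => stat v == d)) /=.
have E1 : \sum_(v : n.-tuple 'I_s | (admissible al v && (stat v < d.+1)%N) && (stat v == d))
    (if stat v == d then c v else c' v) * (mon v).@[word_point w] =
  (\sum_(v : n.-tuple 'I_s | admissible al v && (stat v == d))
      c v *: mon v).@[word_point w].
  rewrite raddf_sum; apply: eq_big => [v|v /andP[_ ->]]; last by rewrite /= mevalZ.
  by case: eqP => [->|]; rewrite ?andbF // ltnSn !andbT.
have E2 : \sum_(v : n.-tuple 'I_s | (admissible al v && (stat v < d.+1)%N) && (stat v != d))
    (if stat v == d then c v else c' v) * (mon v).@[word_point w] =
  \sum_(v : n.-tuple 'I_s | admissible al v && (stat v < d)%N)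
     c' v * (mon v).@[word_point w].
  apply: eq_big => [v|v /andP[_ /negbTE ->] //].
  by rewrite -andbA [(_ < d.+1)%N && _]andbC ltnS -ltn_neqAle.
rewrite E1 E2 -Hc' // -pihomog_words.
have := vf' w aw; rewrite pihomogB !(mevalB, mevalD) => /eqP.
set a := meval _ (pihomog _ _ _); set b := meval _ (pihomog _ _ _).
by rewrite subr_eq0 => /eqP <-; rewrite addrA addrC addrA subrK addrC subrK.
Qed.

Lemma point_indicator w : exists f, forall v, f.@[word_point v] = (v == w)%:R.
Proof.
pose f : {mpoly rat[n]} :=
  \prod_t \prod_(j < s | j != tnth w t) ('X_t - (j%:R)%:MP).
have fE (v : n.-tuple 'I_s) : f.@[word_point v] =
    \prod_t \prod_(j < s | j != tnth w t) ((tnth v t)%:R - j%:R).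
  rewrite rmorph_prod; apply: eq_bigr => t _; rewrite rmorph_prod.
  by apply: eq_bigr => j _; rewrite /= mevalB mevalXU mevalC.
have fw : f.@[word_point w] != 0.
  rewrite fE; apply/prodf_neq0 => t _; apply/prodf_neq0 => j jw.
  by rewrite subr_eq0 eqr_nat eq_sym.
exists (f.@[word_point w]^-1 *: f) => v; rewrite mevalZ.
have [->|ne] := eqVneq; first by rewrite mulVf.
have /existsP[t vt] : [exists t, tnth v t != tnth w t].
  apply: contraNT ne; rewrite negb_exists => /forallP H; apply/eqP.
  by apply: eq_from_tnth => t; apply/eqP; rewrite -[_ == _]negbK.
by rewrite (fE v) (bigD1 t) // (bigD1 (tnth v t)) //= subrr !mul0r mulr0.
Qed.

(** The evaluations of as many monomials as there are points span all
    functions on the points, so they are linearly independent. *)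
Lemma words_free (c : n.-tuple 'I_s -> rat) :
  (forall w, admissible al w ->
    \sum_(v : n.-tuple 'I_s | admissible al v) c v * (mon v).@[word_point w] = 0) ->
  forall w, admissible al w -> c w = 0.
Proof.
move=> Hc w0 aw0; pose A := [set w : n.-tuple 'I_s | admissible al w]%SET.
have sumA (F : n.-tuple 'I_s -> rat) :
    \sum_(v : n.-tuple 'I_s | admissible al v) F v = \sum_(k < #|A|) F (enum_val k).
  by rewrite -(big_enum_val F); apply: eq_bigl => v; rewrite inE.
have evA (k : 'I_#|A|) : admissible al (enum_val k).
  by have := enum_valP k; rewrite inE.
pose E := \matrix_(a < #|A|, b < #|A|) (mon (enum_val a)).@[word_point (enum_val b)].
have /choice[V HV] : forall a : 'I_#|A|, exists c' : n.-tuple 'I_s -> rat,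
    forall w, admissible al w ->
    \sum_(v : n.-tuple 'I_s | admissible al v) c' v * (mon v).@[word_point w]
    = (w == enum_val a)%:R.
  move=> a; have [f Hf] := point_indicator (enum_val a).
  have [c' Hc'] := eval_words (leqnn (msize f)).
  exists (fun v : n.-tuple 'I_s => if (stat v < msize f)%N then c' v else 0) => w aw.
  rewrite -Hf Hc' // big_mkcondr; apply: eq_bigr => v _.
  by case: ifP; rewrite ?mul0r.
have VE : (\matrix_(a < #|A|, k < #|A|) V a (enum_val k)) *m E = 1%:M.
  apply/matrixP => a b; rewrite !mxE eq_sym -(inj_eq enum_val_inj) -HV //.
  by rewrite sumA; apply: eq_bigr => k _; rewrite !mxE.
have cE : (\row_k c (enum_val k)) *m E = 0.
  apply/rowP => b; rewrite !mxE -[RHS](Hc _ (evA b)) sumA.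
  by apply: eq_bigr => k _; rewrite !mxE.
have := congr1 (fun M => M *m \matrix_(a < #|A|, k < #|A|) V a (enum_val k)) cE.
rewrite -mulmxA (mulmx1C VE) mulmx1 mul0mx => /rowP H.
have A0 : w0 \in A by rewrite inE.
by have := H (enum_rank_in A0 w0); rewrite !mxE enum_rankK_in.
Qed.

Lemma homog_words_free (c : n.-tuple 'I_s -> rat) d :
  \sum_(w : n.-tuple 'I_s | admissible al w && (stat w == d)) c w *: mon w \in ideal ->
  forall w, admissible al w -> stat w = d -> c w = 0.
Proof.
set f := \sum_(w | _) _ => If w aw sw.
have hf : f \is d.-homog.
  apply: rpred_sum => v /andP[_ /eqP <-]; apply: dhomogZ; exact: mon_homog.
have [f' [sf' vf']] := ideal_lower_on_points d If; rewrite pihomog_dE // in vf'.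
have [c' Hc'] := eval_words sf'.
(* on the points, the combination of degree [d] is one of smaller degree *)
pose c2 (v : n.-tuple 'I_s) :=
  if stat v == d then c v else if (stat v < d)%N then - c' v else 0.
suff /(_ w aw) : forall v : n.-tuple 'I_s, admissible al v -> c2 v = 0.
  by rewrite /c2 sw eqxx.
apply: words_free => v av; rewrite -[RHS](vf' v av) mevalB Hc' //.
rewrite /f raddf_sum -sumrN big_mkcondr [X in _ = _ + X]big_mkcondr -big_split /=.
apply: eq_bigr => u _; rewrite /c2; case: eqP => [->|_].
  by rewrite ltnn addr0 mevalZ.
by rewrite add0r; case: ifP; rewrite ?mul0r // mulNr.
Qed.

Lemma scale_to_quot G c f : c *: @to_quot n G f = to_quot G (c *: f).
Proof. exact: scale_quotE. Qed.

Lemma to_quot0 G : @to_quot n G 0 = 0.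
Proof. by apply: (addrI (to_quot G 0)); rewrite -to_quotD !addr0. Qed.

Lemma to_quot_sum G (J : finType) (P : pred J) (F : J -> {mpoly rat[n]}) :
  \sum_(j | P j) to_quot G (F j) = to_quot G (\sum_(j | P j) F j).
Proof.
by elim/big_rec2: _ => [|j x y _ ->]; rewrite ?to_quot0 ?to_quotD.
Qed.

Theorem comp_quot_dim d :
  has_dim (@quot_degree n (comp_gens (n := n) al) d)
    #|[set w : n.-tuple 'I_s | admissible al w && (stat w == d)]%SET|.
Proof.
set A := [set w : n.-tuple 'I_s | _]%SET.
have sumA (V : nmodType) (F : n.-tuple 'I_s -> V) :
    \sum_(v : n.-tuple 'I_s | admissible al v && (stat v == d)) F v
    = \sum_(k < #|A|) F (enum_val k).
  by rewrite -(big_enum_val F); apply: eq_bigl => v; rewrite inE.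
have evA (k : 'I_#|A|) : admissible al (enum_val k) /\ stat (enum_val k) = d.
  by have := enum_valP k; rewrite inE => /andP[? /eqP].
exists (fun k : 'I_#|A| => to_quot _ (mon (enum_val k))); split.
- move=> k; exists (mon (enum_val k)) => //=.
  by rewrite -(evA k).2; exact: mon_homog.
- move=> c; under eq_bigr do rewrite scale_to_quot.
  rewrite to_quot_sum -[RHS](to_quot0 _) => /to_quotP; rewrite subr0 => Hc k.
  pose c' (v : n.-tuple 'I_s) := if v \in A then c (enum_rank_in (enum_valP k) v) else 0.
  have ek j : c' (enum_val j) = c j by rewrite /c' enum_valP enum_valK_in.
  rewrite -ek; apply: (homog_words_free (d := d)) => //; try exact: (evA k).1.
    by rewrite sumA; under eq_bigr do rewrite ek.
  exact: (evA k).2.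
move=> _ [f /= hf <-]; have [c Hc] := homog_spanned hf.
exists (fun k : 'I_#|A| => c (enum_val k)); under eq_bigr do rewrite scale_to_quot.
rewrite to_quot_sum; apply/to_quotP.
by rewrite -(sumA _ (fun v : n.-tuple 'I_s => c v *: mon v)).
Qed.

End Basis.

Lemma coef_stat_sum (T : finType) (P : pred T) (F : T -> nat) d :
  (\sum_(x | P x) 'X^(F x) : {poly nat})`_d = #|[set x | P x && (F x == d)]%SET|.
Proof.
rewrite coef_sum -sum1dep_card big_mkcondr /=; apply: eq_bigr => x _.
by rewrite coefXn eq_sym; case: eqP.
Qed.

(** * Rankings by height *)

Section Rankings.
Variable s : nat.
Implicit Types (al : 'I_s -> int) (i j : 'I_s).

(** Column [j] is higher than column [i], or as high and to its left. *)
Definition beats al j i : bool := (al i < al j) || ((al i == al j) && (j < i)%N).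

(** The ranking by height, ties being broken from left to right. *)
Definition height_rank al i : nat := #|[set j | beats al j i]%SET|.

(** Heights with the cells in rows at most 0 forgotten. *)
Definition cut al : 'I_s -> int := fun i => Num.max 0 (al i).

Definition cut_rank al i : nat := height_rank (cut al) i.

Lemma beats_trans al i j k : beats al k j -> beats al j i -> beats al k i.
Proof. by rewrite /beats => /orP[h|/andP[h h']] /orP[g|/andP[g g']]; lia. Qed.

Lemma height_rank_lt al i : (height_rank al i < s)%N.
Proof.
rewrite -[X in (_ < X)%N]card_ord -cardsT; apply: proper_card.
apply/properP; split; first exact: finset.subsetT.
by exists i; rewrite !inE // /beats ltxx ltnn andbF.
Qed.

Lemma height_rank_bij al a : (a < s)%N -> exists i, height_rank al i = a.
Proof.
have mono i j : beats al j i -> (height_rank al j < height_rank al i)%N.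
  move=> ji; apply: proper_card; apply/properP; split.
    by apply/fintype.subsetP => k; rewrite !inE => kj; exact: beats_trans kj ji.
  by exists j; rewrite !inE // /beats ltxx ltnn andbF.
have inj : injective (fun i => Ordinal (height_rank_lt al i)).
  move=> i j [e]; apply/eqP; case: (boolP (beats al j i)) => [/mono|nji].
    by rewrite e ltnn.
  case: (boolP (beats al i j)) => [/mono|nij]; first by rewrite e ltnn.
  move: nij nji; rewrite /beats -val_eqE /=; lia.
move=> lt_a; exists (invF inj (Ordinal lt_a)).
exact: (congr1 val (f_invF inj (Ordinal lt_a))).
Qed.

Lemma height_rank_ge al i c :
  al i <= c -> (#|[set j | (c < al j)%R]%SET| <= height_rank al i)%N.
Proof.
move=> ic; apply: subset_leq_card; apply/fintype.subsetP => j; rewrite !inE /beats => cj.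
by rewrite (le_lt_trans ic cj).
Qed.

Lemma ranking_height_rank : ranking height_rank.
Proof.
split=> [al i|al a|al i c]; [exact: height_rank_lt | exact: height_rank_bij |].
exact: height_rank_ge.
Qed.

Lemma ranking_cut_rank : ranking cut_rank.
Proof.
split=> [al i|al a|al i c ic]; [exact: height_rank_lt | exact: height_rank_bij |].
have -> : [set j | (c%:Z < al j)%R]%SET = [set j | (c%:Z < cut al j)%R]%SET.
  by apply/setP => j; rewrite !inE /cut; lia.
by apply: height_rank_ge; rewrite /cut; lia.
Qed.

End Rankings.

(** * The generators for a partition, and uniqueness of Hilbert series *)

(** The parts of a partition as column heights. *)
Definition col_height (s : nat) (la : seq nat) : 'I_s -> int :=
  fun i => (part la i)%:Z.
Arguments col_height : clear implicits.

(** Parts that are equal to 0 may be added. *)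
Lemma sum_part (la : seq nat) s (F : nat -> nat) : F 0%N = 0%N -> (size la <= s)%N ->
  (\sum_(i < s) F (part la i))%N = (\sum_(p <- la) F p)%N.
Proof.
move=> F0; elim: la s => [|x la IH] s hs.
  by rewrite big_nil big1 // => i _; rewrite /part nth_nil.
by case: s hs => [//|s] hs; rewrite big_ord_recl big_cons /= -(IH s).
Qed.

Lemma excess_part (la : seq nat) s c : (size la <= s)%N ->
  excess (col_height s la) c = (\sum_(p <- la) (p - c))%N.
Proof. by move=> hs; rewrite -(@sum_part la s (fun p => p - c)%N). Qed.

Lemma sum_interval_leq p a n :
  (\sum_(a.+1 <= j < n.+1) (j <= p))%N = (minn p n - a)%N.
Proof.
elim: n => [|n IHn]; first by rewrite big_geq //; lia.
have [an|an] := leqP a n; last by rewrite big_geq //; lia.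
by rewrite big_nat_recr //= IHn; lia.
Qed.

Lemma pnm_excess (la : seq nat) n m : all (fun p => (p <= n)%N) la ->
  pnm n m la = (\sum_(p <- la) (p - (n - m)))%N.
Proof.
move=> hla; rewrite /pnm.
under eq_bigr do rewrite /conj_part -sum1_count big_mkcond /=.
rewrite exchange_big /= [LHS]big_seq [RHS]big_seq; apply: eq_bigr => p pla.
by rewrite -[p in RHS](minn_idPl (allP hla p pla)) -sum_interval_leq.
Qed.

Lemma sum_sub_leq (la : seq nat) c : (\sum_(p <- la) (p - c) <= sumn la - c)%N.
Proof. by elim: la => [|p la IH]; rewrite ?big_nil ?big_cons //=; lia. Qed.

Lemma I_gensE n k s la : (k <= n)%N -> is_partition_of k la -> (size la <= s)%N ->
  I_gens n la s = comp_gens (n := n) (col_height s la).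
Proof.
move=> kn /and3P[_ _ /eqP sla] hs.
have leS (S : {set 'I_n}) : (#|S| <= n)%N by rewrite -[X in (_ <= X)%N]card_ord max_card.
have hla : all (fun p => (p <= n)%N) la.
  apply/allP => p pla; apply: leq_trans kn; rewrite -sla sumnE.
  by rewrite (big_rem p) //= leq_addr.
have ex (S : {set 'I_n}) : excess (col_height s la) (n - #|S|) = pnm n #|S| la.
  by rewrite excess_part // pnm_excess.
apply/seteqP; split=> f [|[S [d]]]; try by left.
  by case=> _ hd ->; right; exists S, d; rewrite ex.
case=> hd ->; right; exists S, d; split=> //; last by rewrite -ex.
case: d hd => // ; rewrite add0n excess_part // => hd.
by have := sum_sub_leq la (n - #|S|); have := leS S; rewrite sla; lia.
Qed.

Lemma has_dim_leq (F : fieldType) (V : lmodType F) (W : set V) d d' :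
  has_dim W d -> has_dim W d' -> (d <= d')%N.
Proof.
case=> b [Wb b_free _] [b' [_ _ b'_span]].
have /choice[M HM] : forall i, exists c : 'I_d' -> F, b i = \sum_j c j *: b' j.
  by move=> i; exact: b'_span.
pose A := \matrix_(i < d, j < d') M i j.
suff /eqP <- : row_free A by exact: rank_leq_col.
apply/inj_row_free => v vA; apply/rowP => i; rewrite mxE.
apply: (b_free (fun i => v 0 i)).
under eq_bigr do rewrite HM scaler_sumr.
rewrite exchange_big big1 //= => j _.
under eq_bigr do rewrite scalerA.
rewrite -scaler_suml; have := congr1 (fun u : 'rV_d' => u 0 j) vA.
by rewrite !mxE; under eq_bigr do rewrite mxE; move=> ->; rewrite scale0r.
Qed.

Lemma has_dim_uniq (F : fieldType) (V : lmodType F) (W : set V) d d' :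
  has_dim W d -> has_dim W d' -> d = d'.
Proof.
by move=> h h'; apply/eqP; rewrite eqn_leq !(has_dim_leq h h', has_dim_leq h' h).
Qed.

(** The Hilbert series is the distribution of the statistic defined by any
    ranking of the columns. *)
Lemma word_Hilbert_series n k s la r : (k <= n)%N -> is_partition_of k la ->
  (size la <= s)%N -> ranking (s := s) r ->
  is_Hilbert_series (R_degree n la s)
    (\sum_(w : n.-tuple 'I_s | admissible (col_height s la) w)
        'X^(word_stat r (col_height s la) w)).
Proof.
move=> kn hla hs rP d; rewrite coef_stat_sum /R_degree /R_quot (I_gensE kn hla hs).
exact: comp_quot_dim.
Qed.

Lemma Hilbert_series_uniq (F : fieldType) (V : lmodType F) (V_ : nat -> set V) P Q :
  is_Hilbert_series V_ P -> is_Hilbert_series V_ Q -> P = Q.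
Proof. by move=> hP hQ; apply/polyP => d; exact: has_dim_uniq (hP d) (hQ d). Qed.

(** * Occurrences of a letter in a word *)

Section Occurrences.
Variables (n s : nat).
Implicit Types (al : 'I_s -> int) (i : 'I_s) (w : n.-tuple 'I_s) (t u : 'I_n).

(** The number of occurrences of [i] before position [t]. *)
Definition occ w t i : nat := count_mem i (take t w).

(** The heights of the columns once the labels smaller than [t.+1] are removed. *)
Definition heights al w t : 'I_s -> int := fun i => al i - (occ w t i)%:Z.

Lemma occ_le w t u i : (t <= u)%N -> (occ w t i <= occ w u i)%N.
Proof.
by move=> tu; rewrite /occ -(subnKC tu) takeD count_cat leq_addr.
Qed.

Lemma occ_lt w t u i : (t < u)%N -> tnth w t = i -> (occ w t i < occ w u i)%N.
Proof.
move=> tu wt; rewrite /occ -(subnKC tu) takeD count_cat.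
rewrite (take_nth i) ?size_tuple // -cats1 count_cat /= -(tnth_nth i) wt eqxx.
by rewrite addn0 addn1 ltnS leq_addr.
Qed.

Lemma occ_lt_count w t i : tnth w t = i -> (occ w t i < count_mem i w)%N.
Proof.
move=> wt; rewrite -[X in count_mem i X](cat_take_drop t.+1) count_cat /occ.
rewrite (take_nth i) ?size_tuple // -cats1 count_cat /= -(tnth_nth i) wt eqxx.
by rewrite addn0 addn1 ltnS leq_addr.
Qed.

Lemma occ_le_count w t i : (occ w t i <= count_mem i w)%N.
Proof. by rewrite -[X in count_mem i X](cat_take_drop t) count_cat leq_addr. Qed.

Lemma count_take_surj i k (w : seq 'I_s) : (k < count_mem i w)%N ->
  exists2 t, (t < size w)%N & nth i w t = i /\ count_mem i (take t w) = k.
Proof.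
elim: w k => [|x w IH] //= k; have [->|xi] := eqVneq x i.
  case: k => [|k]; first by exists 0%N; rewrite ?take0.
  rewrite add1n ltnS => /IH[t tw [e <-]]; exists t.+1 => //=.
  by rewrite eqxx.
rewrite add0n => /IH[t tw [e <-]]; exists t.+1 => //=.
by rewrite (negbTE xi).
Qed.

Lemma occ_surj w i k : (k < count_mem i w)%N ->
  exists t, tnth w t = i /\ occ w t i = k.
Proof.
case/count_take_surj => t; rewrite size_tuple => tn [e c].
by exists (Ordinal tn); rewrite (tnth_nth i).
Qed.

Lemma occ_surj_lt w i k u : (k < occ w u i)%N ->
  exists t, [/\ (t < u)%N, tnth w t = i & occ w t i = k].
Proof.
move=> ku; have [|t [wt ot]] := @occ_surj w i k.
  exact: leq_trans ku (occ_le_count _ _ _).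
exists t; split=> //; rewrite ltnNge; apply/negP => /(occ_le w i).
by rewrite ot leqNgt ku.
Qed.

End Occurrences.

Lemma word_stat_heights n s (f : ('I_s -> int) -> 'I_s -> nat) (al : 'I_s -> int)
    (w : n.-tuple 'I_s) :
  word_stat f al w = (\sum_(t < n) f (heights al w t) (tnth w t))%N.
Proof.
elim: n al w => [|n IHn] al w; first by rewrite tuple0 big_ord0.
case/tupleP: w => i w; rewrite big_ord_recl /=; congr (_ + _)%N.
  rewrite tnth0; congr f; apply/funext => j.
  by rewrite /heights /occ take0 subr0.
rewrite IHn; apply: eq_bigr => t _; rewrite tnthS; congr f; apply/funext => j.
by rewrite /heights /lower /occ /= -addrA -opprD PoszD eq_sym.
Qed.

Lemma word_stat_card n s (g : ('I_s -> int) -> 'I_s -> int) (al : 'I_s -> int)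
    (w : n.-tuple 'I_s) :
  word_stat (fun be => height_rank (g be)) al w =
  #|[set p : 'I_n * 'I_s | beats (g (heights al w p.1)) p.2 (tnth w p.1)]%SET|.
Proof.
rewrite word_stat_heights -sum1dep_card.
rewrite (eq_bigl (fun p : 'I_n * 'I_s => xpredT p.1 &&
  beats (g (heights al w p.1)) p.2 (tnth w p.1))) //.
rewrite -(pair_big_dep xpredT (fun t i => beats (g (heights al w t)) i (tnth w t))
  (fun _ _ => 1%N)) /=.
by apply: eq_bigr => t _; rewrite sum1dep_card.
Qed.

(** * Column-increasing fillings as words *)

Section FillingOfWord.
Variables (n s : nat) (la : seq nat).
Local Notation al := (col_height s la).
Implicit Types (w : n.-tuple 'I_s) (t u : 'I_n) (c : cell s).

(** The cell labelled [t.+1] lies in column [tnth w t], below the cells that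
    carry the smaller labels of that column. *)
Definition word_cell w t : cell s := (tnth w t, heights al w t (tnth w t)).

(** The labels are the positions in the word, counted from 1. *)
Definition word_filling w : filling s :=
  [fmap c : [fset word_cell w t | t in 'I_n]%fset =>
     (index (val c) [seq word_cell w t | t <- enum 'I_n]).+1].

Lemma word_cell_inj w : injective (word_cell w).
Proof.
move=> t u [e]; rewrite -e /heights => /addrI /oppr_inj [e'].
apply: val_inj; case: (ltngtP t u) => // [tu|ut].
  by have := occ_lt tu (erefl (tnth w t)); rewrite e' ltnn.
by have := occ_lt ut (esym e); rewrite e' ltnn.
Qed.

Lemma mem_word_filling w c :
  (c \in domf (word_filling w)) <-> exists t, c = word_cell w t.
Proof.
split; first by case/imfsetP => t _ ->; exists t.
by case=> t ->; apply/imfsetP; exists t.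
Qed.

Lemma word_filling_cell w t : cells (word_filling w) (word_cell w t).
Proof. by apply/mem_word_filling; exists t. Qed.

Lemma word_filling_fnd w t : (word_filling w).[? word_cell w t]%fmap = Some t.+1.
Proof.
rewrite in_fnd; first exact: word_filling_cell.
move=> h; rewrite ffunE /= index_map; last exact: word_cell_inj.
by rewrite index_enum_ord.
Qed.

Lemma label_word_filling w t : label (word_filling w) (word_cell w t) = t.+1.
Proof. by rewrite /label word_filling_fnd. Qed.

Lemma word_filling_inj : injective word_filling.
Proof.
move=> w w' e; apply: eq_from_tnth => t.
have := word_filling_cell w t; rewrite {1}e => /mem_word_filling[u eu].
have := label_word_filling w t; rewrite e {1}eu label_word_filling => -[ut].
have {}ut : u = t by apply: val_inj.
by move: eu; rewrite ut => -[].
Qed.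

(** The cell [(i, j)] survives the removal of the labels [1, ..., t] if and only if
    it carries none of them. *)
Lemma le_heights w t (i : 'I_s) (j : int) : j <= al i ->
  j <= heights al w t i <-> (forall u, word_cell w u = (i, j) -> (t <= u)%N).
Proof.
move=> ji; split=> [jt u [wu ju]|H].
  rewrite leqNgt; apply/negP => ut; have := occ_lt ut wu.
  by move: jt; rewrite -ju wu /heights; lia.
rewrite leNgt; apply/negP => jt.
have [k ek] : exists k : nat, al i - j = k by exists `|al i - j|%N; lia.
have [|u [ut wu ou]] := @occ_surj_lt _ _ w i k t.
  by move: jt ek; rewrite /heights; lia.
have /H : word_cell w u = (i, j).
  by rewrite /word_cell wu /heights ou -ek subKr.
by rewrite leqNgt ut.
Qed.

Lemma cells_word_filling w i j :
  cells (word_filling w) (i, j) <-> al i - (count_mem i w)%:Z < j <= al i.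
Proof.
split=> [/mem_word_filling[t [-> ->]]|/andP[j1 j2]].
  have := occ_lt_count (erefl (tnth w t)).
  by rewrite /heights; move: (occ w t _) (count_mem _ _) (al _) => a b d; lia.
have [k ek] : exists k : nat, al i - j = k by exists `|al i - j|%N; lia.
have [|u [wu ou]] := @occ_surj _ _ w i k; first by lia.
apply/mem_word_filling; exists u; rewrite /word_cell wu /heights ou -ek.
by rewrite subKr.
Qed.

Lemma word_filling_SECI w : admissible al w -> SECI n la s (word_filling w).
Proof.
move=> /forallP aw; split.
- exists (fun i => (count_mem i w - part la i)%N).
  apply/seteqP; split=> -[i j].
    move/cells_word_filling; have := aw i; rewrite /dg /basement /col_height /=.
    move: (count_mem i w) (part la i) => a b ab hj.
    by case: (leP j 0) => j0; [right|left]; lia.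
  move=> h; apply/cells_word_filling; have := aw i.
  case: h; rewrite /dg /basement /col_height /=;
    by move: (count_mem i w) (part la i) => a b; lia.
- rewrite card_imfset /=; last exact: word_cell_inj.
  by rewrite -cardE card_ord.
- split=> [c /mem_word_filling[t ->]|c c'|m /= /andP[m0 mn]].
  + by rewrite label_word_filling /= ltn_ord.
  + rewrite !inE => /mem_word_filling[t ->] /mem_word_filling[u ->].
    by rewrite !label_word_filling => -[/val_inj ->].
  have mn' : (m.-1 < n)%N by lia.
  exists (word_cell w (Ordinal mn')); first exact: word_filling_cell.
  by rewrite label_word_filling /= prednK.
move=> i j j' /mem_word_filling[t e] /mem_word_filling[u e'] jj'.
rewrite e e' !label_word_filling ltnS ltnNge; apply/negP => /(occ_le w i).
case: e e' => ei ej [ei' ej']; move: jj'; rewrite ej ej' /heights -ei -ei'.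
lia.
Qed.

End FillingOfWord.

(** In a column-increasing filling, the label [t.+1] of column [i] is just below
    the smaller labels of that column; this determines the filling from the
    columns of the labels. *)
Lemma word_filling_surj n s la (phi : filling s) : SECI n la s phi ->
  exists w : n.-tuple 'I_s, admissible (col_height s la) w /\ word_filling la w = phi.
Proof.
set al := col_height s la.
case=> -[b Db] _ [lab_fun lab_inj lab_surj] col_incr.
have Dup i (j j' : int) : cells phi (i, j) -> j <= j' <= al i -> cells phi (i, j').
  rewrite Db => h /andP[j1 j2]; case: h; rewrite /dg /basement /= => /andP[h1 h2].
    by left; rewrite /dg /= j2 (le_trans h1 j1).
  have [h|h] := lerP j' 0; [right | left]; apply/andP; split=> //=.
  exact: lt_le_trans h1 j1.
have Dle i j : cells phi (i, j) -> j <= al i.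
  rewrite Db /al /col_height; case; rewrite /dg /basement /= => /andP[h1 h2] //.
  by apply: le_trans h2 _.
have /choice[cs Hcs] : forall t : 'I_n, exists c, cells phi c /\ label phi c = t.+1.
  move=> t; have [|c cD lc] := lab_surj t.+1; first by rewrite /= ltn_ord.
  by exists c.
have cs_onto c : cells phi c -> exists t, c = cs t.
  move=> cD; have /andP[l0 ln] := lab_fun c cD.
  have ln' : ((label phi c).-1 < n)%N by lia.
  exists (Ordinal ln'); apply: lab_inj; rewrite ?inE //; first exact: (Hcs _).1.
  by rewrite (Hcs _).2 /= prednK.
have cs_inj : injective cs.
  by move=> t u e; apply: val_inj; have := (Hcs t).2; rewrite e (Hcs u).2 => -[].
pose w : n.-tuple 'I_s := [tuple (cs t).1 | t < n].
have wE t : tnth w t = (cs t).1 by rewrite tnth_mktuple.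
have csE t : cs t = word_cell la w t.
  have [m le_tm] := ubnP t; elim: m t le_tm => // m IHm t; rewrite ltnS => tm.
  have IH (u : 'I_n) : (u < t)%N -> cs u = word_cell la w u.
    by move=> ut; apply: IHm; exact: leq_trans ut tm.
  rewrite /word_cell wE; case E : (cs t) (Hcs t) => [i j] /= [tD tl].
  congr (_, _); apply/eqP; rewrite eq_le.
  apply/andP; split; rewrite leNgt; apply/negP => jt.
    (* the row of the cell has already received a smaller label *)
    have [k ek] : exists k : nat, al i - j = k.
      by exists `|al i - j|%N; have := Dle _ _ tD; lia.
    have [|u [ut wu ou]] := @occ_surj_lt _ _ w i k t.
      by move: jt ek; rewrite /heights -/al; lia.
    have := IH u ut; rewrite /word_cell wu /heights ou -/al -ek subKr => eu.
    by have := cs_inj _ _ (etrans eu (esym E)) => tu; rewrite tu ltnn in ut.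
  (* the cell just below the smaller labels of the column carries one of them *)
  have [|u eu] := cs_onto (i, heights al w t i).
    by apply: Dup tD _; rewrite ltW //= /heights gerBl.
  have ut : (u < t)%N.
    have := col_incr _ _ _ (Dup _ _ _ tD _) tD jt; rewrite eu (Hcs u).2 tl ltnS; apply.
    by rewrite ltW //= /heights gerBl.
  have := IH u ut; rewrite -eu => -[wu].
  rewrite -wu /heights -/al => /addrI /oppr_inj [] e.
  by have := occ_lt ut (esym wu); rewrite e ltnn.
have aw : admissible al w.
  apply/forallP => i; have [ai|ai] := leP (al i) 0; first exact: le_trans ai _.
  have [|t et] := cs_onto (i, 1).
    by rewrite Db; left; move: ai; rewrite /al /col_height /dg /=; lia.
  move: et; rewrite csE => -[wt /esym]; rewrite /heights -/al -wt => o1.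
  have := occ_lt_count (esym wt).
  by move: o1; move: (occ w t i) (count_mem i w) => x y; lia.
exists w; split=> //; apply/fmapP => c.
have [cD|cD] := boolP (c \in domf phi).
  have [t ->] := cs_onto c cD; rewrite {1}csE word_filling_fnd.
  by have [tD] := Hcs t; rewrite /label in_fnd /= => ->.
rewrite [RHS]not_fnd // not_fnd //; apply: contraNN cD => /mem_word_filling[t ->].
by rewrite -csE; exact: (Hcs t).1.
Qed.

Lemma word_filling_bij n s la :
  set_bij [set w : n.-tuple 'I_s | admissible (col_height s la) w] (SECI n la s)
    (word_filling la).
Proof.
split=> [w /= aw|w w' _ _|phi /word_filling_surj[w [aw <-]]].
- exact: word_filling_SECI.
- exact: word_filling_inj.
by exists w.
Qed.

Lemma sum_SECI n s la (F : filling s -> {poly nat}) :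
  \sum_(phi \in SECI n la s) F phi =
  \sum_(w : n.-tuple 'I_s | admissible (col_height s la) w) F (word_filling la w).
Proof.
rewrite (@reindex_fsbig _ _ _ _ _ _ _ _ F (@word_filling_bij n s la)).
pose P : pred (n.-tuple 'I_s) := fun w => admissible (col_height s la) w.
have -> : [set w : n.-tuple 'I_s | admissible (col_height s la) w] = [set` enum P].
  by apply/seteqP; split=> w /=; rewrite mem_enum.
by rewrite -fsbig_seq ?enum_uniq // big_enum.
Qed.

Lemma count_set_image (T : finType) (U : choiceType) (A : set U) (B : {set T})
    (g : T -> U) :
  {in B &, injective g} -> (forall x, x \in B -> A (g x)) ->
  (forall y, A y -> exists2 x, x \in B & g x = y) -> count_set A = #|B|.
Proof.
move=> g_inj gA Ag; rewrite /count_set.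
have -> : A = [set` [fset g x | x in B]%fset].
  apply/seteqP; split=> y /=; first by case/Ag=> x xB <-; apply/imfsetP; exists x.
  by case/imfsetP=> x xB ->; exact: gA.
by rewrite set_fsetK card_in_imfset //= -cardE.
Qed.

(** * The two statistics as sums over the labels *)

Section Statistics.
Variables (n s : nat) (la : seq nat) (w : n.-tuple 'I_s).
Local Notation al := (col_height s la).
Hypothesis aw : admissible al w.
Local Notation phi := (word_filling la w).
Local Notation wcell := (word_cell la w).
Local Notation hts := (heights al w).

(** The row in column [i] of the coordinate that attacks [wcell t]. *)
Definition attacker_row (t : 'I_n) (i : 'I_s) : int :=
  (wcell t).2 + (if (i < tnth w t)%N then 0 else 1).

(** The pairs in which [wcell t] is the second coordinate are indexed by the
    columns. *)
Definition attacking_pair (p : 'I_n * 'I_s) : cell s * cell s :=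
  ((p.2, attacker_row p.1 p.2), wcell p.1).

Lemma attacking_pair_inj : injective attacking_pair.
Proof.
move=> [t i] [u j] [-> _ e1 e2].
by rewrite (@word_cell_inj _ _ la w t u) // /word_cell -e2 e1.
Qed.

Lemma attacksP (c : cell s) t : attacks c (wcell t) <->
  c.1 != tnth w t /\ c.2 = attacker_row t c.1.
Proof.
rewrite /attacks /attacker_row -val_eqE /=; split.
  case=> [[e lt_c]|[e lt_c]]; first by rewrite lt_c addr0 ltn_eqF.
  by rewrite ltnNge (ltnW lt_c) /= gtn_eqF.
case=> ne; case: ltnP => [lt_c|ge_c] e; first by left; rewrite e addr0.
by right; split=> //=; rewrite ltn_neqAle eq_sym ne.
Qed.

Lemma beatsE t i : beats (hts t) i (tnth w t) =
  (i != tnth w t) && (attacker_row t i <= hts t i).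
Proof.
rewrite /beats /attacker_row /word_cell /= -val_eqE /=.
have [->|ne] := eqVneq i (tnth w t); first by rewrite ltxx !eqxx ltnn.
by move: ne; rewrite -val_eqE /=; move: (hts t _) (hts t _) => x y; case: ltnP; lia.
Qed.

Lemma hts_le t i : hts t i <= al i.
Proof. by rewrite /heights gerBl. Qed.

(** A cell in another column survives the removal of the labels [1, ..., t] if and
    only if its label exceeds [t.+1]. *)
Lemma le_hts_label t (c : cell s) : c.1 != tnth w t -> cells phi c -> c.2 <= al c.1 ->
  (c.2 <= hts t c.1) = (label phi (wcell t) < label phi c)%N.
Proof.
case: c => i j /= ne /mem_word_filling[v ev] ji.
rewrite ev !label_word_filling ltnS; apply/idP/idP => [/(le_heights w t ji) H|tv].
  rewrite ltn_neqAle H // andbT; apply: contraNneq ne => /val_inj tv.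
  by rewrite tv; case: ev => ->.
apply/(le_heights w t ji) => u; rewrite ev => /word_cell_inj ->.
exact: ltnW.
Qed.

(** So does a coordinate that carries no label. *)
Lemma le_hts_out t (c : cell s) : ~ cells phi c -> c.2 <= al c.1 -> c.2 <= hts t c.1.
Proof.
case: c => i j /= cD ji; apply/(le_heights w t ji) => u eu.
by case: cD; rewrite -eu; exact: word_filling_cell.
Qed.

Lemma dg_cells (c : cell s) : dg la c -> cells phi c.
Proof. by move=> dc; case: (word_filling_SECI aw) => -[b ->] _ _ _; left. Qed.

Lemma dinv_word_stat : seci_dinv la phi = word_stat (@height_rank s) al w.
Proof.
rewrite (@word_stat_card n s id).
apply: (count_set_image (g := attacking_pair)).
- by move=> p q _ _; exact: attacking_pair_inj.
- move=> [t i]; rewrite inE beatsE /= => /andP[ne ti].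
  have i_al : attacker_row t i <= al i by apply: le_trans ti (hts_le t i).
  have att : attacks (i, attacker_row t i) (wcell t) by apply/attacksP.
  split; first by split=> //=; exact: hts_le.
  have [cD|cD] := pselect (cells phi (i, attacker_row t i)).
    left; split=> //; first exact: word_filling_cell.
    by rewrite -(le_hts_label (c := (i, _))).
  have row_le : (wcell t).2 <= attacker_row t i.
    by rewrite /attacker_row; case: ifP; rewrite ?addr0 // lerDl.
  have row0 : attacker_row t i <= 0.
    rewrite leNgt; apply/negP => pos; apply: cD; apply: dg_cells.
    by rewrite /dg /= i_al andbT -gtz0_ge1.
  right; split=> //=; first exact: le_trans row_le row0.
  exact: word_filling_cell.
move=> [c c'] [[/= c_al c'_al att] lab].
have : cells phi c' by case: lab => -[].
case/mem_word_filling => t et; rewrite {}et in att lab c'_al *.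
have /attacksP[ne row] := att.
exists (t, c.1); last by rewrite /attacking_pair /= -row; case: (c).
rewrite inE beatsE /= ne -row /=.
case: lab => [[cD _ lab]|[_ _ cD _]]; last exact: le_hts_out.
by rewrite le_hts_label.
Qed.

(** The columns counted by the rank of the column of [wcell t] for the heights
    [cut (hts t)]: if [wcell t] lies in a row at most 0, they are all the columns
    to the left, and the columns to the right that still meet row 1. *)
Lemma beats_cutE t i : beats (cut (hts t)) i (tnth w t) =
  if 0 < (wcell t).2 then beats (hts t) i (tnth w t)
  else (i < tnth w t)%N || ((tnth w t < i)%N && (0 < hts t i)).
Proof.
rewrite /beats /cut /word_cell /=.
have [->|ne] := eqVneq i (tnth w t); first by rewrite !ltxx !eqxx !ltnn /=; case: ifP.
move: ne; rewrite -val_eqE /=; move: (hts t _) (hts t _) => x y.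
by case: ltngtP => // _ _; case: (ltP 0 y) => y0; rewrite ?andbT ?andbF ?orbT ?orbF; lia.
Qed.

Lemma inv_word_stat : seci_inv la phi = word_stat (@cut_rank s) al w.
Proof.
rewrite (@word_stat_card n s (@cut s)).
set B := [set p | _]%SET.
(* the pairs [(t, i)] that correspond to (I1), (I2) and (I3) *)
pose Bp := [set p in B | (0 < (wcell p.1).2)%R]%SET.
pose Bn := [set p in B | ((wcell p.1).2 <= 0)%R & (tnth w p.1 < p.2)%N]%SET.
pose Bb := [set p in B | ((wcell p.1).2 <= 0)%R & (p.2 < tnth w p.1)%N]%SET.
have -> : #|B| = (#|Bp| + #|Bn| + #|Bb|)%N.
  have cardB (Q : pred ('I_n * 'I_s)) :
      #|[set p in B | Q p]%SET| = (\sum_p ((p \in B) && Q p : nat))%N.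
    by rewrite -sum1dep_card big_mkcond; apply: eq_bigr => p _; case: (_ && _).
  have -> : #|B| = (\sum_p (p \in B : nat))%N.
    by rewrite -sum1_card big_mkcond; apply: eq_bigr => p _; case: (_ \in _).
  rewrite !cardB -!big_split /=; apply: eq_bigr => -[t i] _.
  rewrite inE beats_cutE /=; case: ltP => _ //=; first by case: beats.
  by case: ltngtP; case: ltP.
congr (_ + _ + _)%N.
- apply: (count_set_image (g := attacking_pair)).
  + by move=> p q _ _; exact: attacking_pair_inj.
  + move=> [t i]; rewrite !inE /= beats_cutE => /andP[h pos].
    move: h; rewrite pos beatsE => /andP[ne ti].
    have i_al : attacker_row t i <= al i by apply: le_trans ti (hts_le t i).
    have dgc : dg la (i, attacker_row t i).
      rewrite /dg /= i_al andbT -gtz0_ge1 /attacker_row.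
      by case: ifP => _; rewrite ?addr0 // addr_gt0.
    split=> //; last by apply/attacksP.
      by rewrite /dg /= hts_le andbT -gtz0_ge1.
    by rewrite -(le_hts_label (c := (i, _))) //; exact: dg_cells.
  move=> [c c'] [/= dc dc' lab att].
  case/mem_word_filling: (dg_cells dc') => t et; rewrite {}et in att lab dc' *.
  have /attacksP[ne row] := att; have /andP[c1 c_al] := dc; have /andP[c'1 _] := dc'.
  exists (t, c.1); last by rewrite /attacking_pair /= -row; case: (c).
  rewrite !inE /= beats_cutE gtz0_ge1 c'1 andbT beatsE ne -row /=.
  by rewrite le_hts_label //; exact: dg_cells.
- apply: (count_set_image (g := fun p => ((p.2, 1), wcell p.1))).
  + move=> [t i] [u j] _ _ [-> e1 e2].
    by rewrite (@word_cell_inj _ _ la w t u) // /word_cell -e2 e1.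
  + move=> [t i]; rewrite !inE /= beats_cutE => /and3P[h neg lt_ti]; move: h.
    rewrite ltNge neg /= lt_ti ltnNge (ltnW lt_ti) /= => hi.
    have hi1 : 1 <= hts t i by rewrite -gtz0_ge1.
    have dgc : dg la (i, 1 : int).
      by rewrite /dg /=; apply: le_trans hi1 (hts_le t i).
    have ne : i != tnth w t by rewrite -val_eqE /= gtn_eqF.
    have lab := le_hts_label (c := (i, 1 : int)) ne (dg_cells dgc).
    split=> //; first by split=> //; exact: word_filling_cell.
    by rewrite -lab // (le_trans hi1 (hts_le t i)).
  move=> [[i j] c'] [/= [dc j1] [c'D c'0] lt_c lab].
  rewrite {}j1 in dc lab *.
  case/mem_word_filling: c'D => t et; rewrite {}et in c'0 lt_c lab *.
  exists (t, i) => //; have ne : i != tnth w t by rewrite -val_eqE /= gtn_eqF.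
  rewrite !inE /= beats_cutE c'0 lt_c ltNge c'0 /= andbT; apply/orP; right.
  rewrite gtz0_ge1 (@le_hts_label t (i, 1)) //; exact: dg_cells.
apply: (count_set_image (g := fun p => (p.2, wcell p.1))).
- move=> [t i] [u j] _ _ [-> e1 e2].
  by rewrite (@word_cell_inj _ _ la w t u) // /word_cell -e2 e1.
- move=> [t i]; rewrite !inE /= => /and3P[_ neg lt_it].
  by split=> //; split=> //; exact: word_filling_cell.
move=> [i c'] [/= [c'D c'0] lt_c].
case/mem_word_filling: c'D => t et; rewrite {}et in c'0 lt_c *.
by exists (t, i) => //; rewrite !inE /= beats_cutE ltNge c'0 lt_c.
Qed.

End Statistics.

Theorem corollary5p14 (n k s : nat) (la : seq nat)
    (hk : (0 < k)%N) (hkn : (k <= n)%N) (hs : (0 < s)%N)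
    (hla : is_partition_of k la) (hlas : (size la <= s)%N) :
  is_Hilbert_series (R_degree n la s)
    (\sum_(phi \in SECI n la s) ('X^(seci_inv la phi) : {poly nat}))
  /\
  \sum_(phi \in SECI n la s) ('X^(seci_inv la phi) : {poly nat}) =
  \sum_(phi \in SECI n la s) ('X^(seci_dinv la phi) : {poly nat}).
Proof.
rewrite !sum_SECI.
under eq_bigr => w aw do rewrite (inv_word_stat aw).
under [X in _ = X]eq_bigr => w aw do rewrite (dinv_word_stat aw).
have H := word_Hilbert_series hkn hla hlas.
have Hinv := H _ (@ranking_cut_rank s).
by split=> //; apply: Hilbert_series_uniq Hinv (H _ (@ranking_height_rank s)).
Qed.
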